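(* Let \[ \mathcal{C} = 1-\int_0^1 \left(\frac{1}{t(e^t-1)} - \frac{1}{t^2}+\frac{1}{2t} \right)dt - \int_1^\infty \frac{dt}{t(e^t-1)}. \] Then $\mathcal{C}=\frac12(\log 2\pi-\gamma)$, where $\gamma$ is the Euler constant, and for all coprime integers $m,n\ge 1$, \[ \begin{aligned} mn\int_0^\infty \left(\frac{1}{mt}-\frac{1}{e^{mt}-1}\right)\left(\frac{1}{nt}-\frac{1}{e^{nt}-1}\right) dt = {}& -\frac{1}{2} + \mathcal{C}\,(n+m) + \frac{m-n}{2}\log\left(\frac{n}{m}\right) \\ & - \frac{\pi}{2} \sum_{k=1}^{n-1}\frac{m k}{n} \cot\left(\frac{m k \pi}{n}\right) - \frac{\pi}{2} \sum_{l=1}^{m-1} \frac{n l}{m} \cot\left(\frac{n l \pi}{m}\right). \end{aligned} \]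
   Context: $\gamma$ denotes the Euler(–Mascheroni) constant and $\log$ the natural logarithm. Empty sums are zero. *)

(* Defs.v *)
(* Stdlib real numbers with Coquelicot. *)
From Stdlib Require Import Reals.
From Coquelicot Require Import Coquelicot.
Open Scope R_scope.

Definition euler_gamma : R :=
  real (Lim_seq (fun N : nat => sum_n_m (fun k => / INR k) 1 N - ln (INR N))).

(* [cos x / sin x] rather than [/ tan x]: [tan (PI / 2)] is a junk value. *)
Definition cot (x : R) : R := cos x / sin x.

Definition calC_integrand_0_1 (t : R) : R :=
  / (t * (exp t - 1)) - / t ^ 2 + / (2 * t).

Definition calC_integrand_1_infty (t : R) : R :=
  / (t * (exp t - 1)).

(* Taken over ]0, 1], since the integrand has a removable singularity at 0. *)
Definition calC : R :=
  1 - RInt_gen calC_integrand_0_1 (at_right 0) (at_point 1)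
    - RInt_gen calC_integrand_1_infty (at_point 1) (Rbar_locally p_infty).

Definition autocorr_integrand (m n : nat) (t : R) : R :=
  (/ (INR m * t) - / (exp (INR m * t) - 1)) *
  (/ (INR n * t) - / (exp (INR n * t) - 1)).

(* Main.v *)
(* Write q = e^{-t}.  Expanding the product, the integrand times mn is
     1/t^2 - n/(t(e^{nt}-1)) - m/(t(e^{mt}-1)) + mn/((e^{mt}-1)(e^{nt}-1)).
   The second and third terms are dilations of 1/(t(e^t-1)), whose primitive
   behaves like -1/t - (log t)/2 + const at 0; the constant is governed by calC.
   The last term is a rational function of q.  Its coefficient at q^N counts the
   solutions of mi + nj = N with i, j >= 1, which Popoviciu's formula expresses
   through two sawtooth functions; Eisenstein's finite Fourier expansion of the
   sawtooth then gives the partial fraction decomposition, with cotangents as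
   coefficients and terms q sin(2p)/(1 - 2q cos(2p) + q^2), p = k pi/n, each of
   integral pi/2 - p.

   For the value of calC, integrate 1/(t(e^t+1)) - e^{-t}/(2t) in two ways:
   1/(e^t+1) = 1/(e^t-1) - 2/(e^{2t}-1) expresses it by calC and the constant of
   the exponential integral (which is gamma), while expanding 1/(e^t+1) in powers
   of q and applying Frullani's formula termwise gives Wallis' product. *)
Require Import Defs.
From Stdlib Require Import Reals Lra Lia.
From Coquelicot Require Import Coquelicot.
Open Scope R_scope.

(** * Limits and antiderivatives *)

(* [sum_n_m] yields equations typed in an algebraic structure, which [ring] and
   [field] do not recognise as equations in [R]. *)
Ltac eq_in_R := match goal with |- ?a = ?b => change (@eq R a b) end.

Lemma increment_le_of_derive (F G f g : R -> R) (x y : R) :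
  x <= y ->
  (forall t, x <= t <= y -> is_derive F t (f t)) ->
  (forall t, x <= t <= y -> is_derive G t (g t)) ->
  (forall t, x <= t <= y -> f t <= g t) ->
  F y - F x <= G y - G x.
Proof.
intros xy dF dG fg.
destruct (MVT_gen (fun t => G t - F t) x y (fun t => g t - f t)) as [c [cI Hc]].
- intros t; rewrite Rmin_left, Rmax_right by lra; intros Ht.
  apply (is_derive_minus G F); [apply dG | apply dF]; lra.
- intros t; rewrite Rmin_left, Rmax_right by lra; intros Ht.
  apply continuity_pt_filterlim, (ex_derive_continuous (fun t => G t - F t)).
  exists (g t - f t); apply (is_derive_minus G F); [apply dG | apply dF]; lra.
- rewrite Rmin_left, Rmax_right in cI by lra.
  assert (0 <= (g c - f c) * (y - x)).
  { apply Rmult_le_pos; [specialize (fg c cI)|]; lra. }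
  lra.
Qed.

Lemma sum_n_m_Sr (u : nat -> R) (n m : nat) :
  (n <= S m)%nat -> sum_n_m u n (S m) = sum_n_m u n m + u (S m).
Proof. intros; rewrite sum_n_Sm; auto. Qed.

Lemma sum_n_m_Rplus (u v : nat -> R) (n m : nat) :
  sum_n_m (fun k => u k + v k) n m = sum_n_m u n m + sum_n_m v n m.
Proof. exact (sum_n_m_plus u v n m). Qed.

Lemma sum_n_m_Rmult_l (c : R) (u : nat -> R) (n m : nat) :
  sum_n_m (fun k => c * u k) n m = c * sum_n_m u n m.
Proof. exact (sum_n_m_mult_l c u n m). Qed.

Section FilterLimits.
Context {T : Type} {Fil : (T -> Prop) -> Prop} {FF : Filter Fil}.

Lemma lim_plus (f g : T -> R) (a b : R) :
  filterlim f Fil (locally a) -> filterlim g Fil (locally b) ->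
  filterlim (fun x => f x + g x) Fil (locally (a + b)).
Proof.
intros Hf Hg; exact (filterlim_comp_2 _ _ _ Hf Hg (filterlim_plus a b)).
Qed.

Lemma lim_scal (c : R) (f : T -> R) (a : R) :
  filterlim f Fil (locally a) ->
  filterlim (fun x => c * f x) Fil (locally (c * a)).
Proof.
intros Hf; exact (filterlim_comp _ _ _ _ _ _ _ _ Hf (filterlim_scal_r c a)).
Qed.

Lemma lim_minus (f g : T -> R) (a b : R) :
  filterlim f Fil (locally a) -> filterlim g Fil (locally b) ->
  filterlim (fun x => f x - g x) Fil (locally (a - b)).
Proof.
intros Hf Hg.
replace (a - b) with (a + -1 * b) by ring.
apply (filterlim_ext (fun x => f x + -1 * g x)); [intros; ring|].
exact (lim_plus _ _ _ _ Hf (lim_scal (-1) _ _ Hg)).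
Qed.

Lemma lim_continuous (phi : R -> R) (f : T -> R) (a : R) :
  continuous phi a -> filterlim f Fil (locally a) ->
  filterlim (fun x => phi (f x)) Fil (locally (phi a)).
Proof. intros Hphi Hf; exact (filterlim_comp _ _ _ _ _ _ _ _ Hf Hphi). Qed.

End FilterLimits.

(** Cauchy's criterion: [|F y - F x| <= |G y - G x|] on the order-convex set [P], so [F] inherits
    the Cauchy property from [G]. It yields limits of primitives that have no closed form; with the
    filter abstract, one statement serves both 0 and infinity. *)
Lemma ex_limit_of_dominated (Fil : (R -> Prop) -> Prop) (FF : ProperFilter Fil)
    (P : R -> Prop) (F G f g : R -> R) (l : R) :
  Fil P ->
  (forall x y t, P x -> P y -> x <= t <= y -> P t) ->
  (forall t, P t -> is_derive F t (f t)) ->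
  (forall t, P t -> is_derive G t (g t)) ->
  (forall t, P t -> Rabs (f t) <= g t) ->
  filterlim G Fil (locally l) ->
  exists l', filterlim F Fil (locally l').
Proof.
intros FP Pconv dF dG fg Gl.
assert (key : forall x y, P x -> P y -> x <= y -> Rabs (F y - F x) <= G y - G x).
{ intros x y Px Py xy; apply Rabs_le; split.
  - assert (H : - G y - - G x <= F y - F x); [|lra].
    apply (increment_le_of_derive (fun t => - G t) F (fun t => - g t) f); auto.
    + intros t Ht; apply (is_derive_opp G); apply dG; eauto.
    + intros t Ht; apply dF; eauto.
    + intros t Ht; assert (Pt : P t) by eauto.
      generalize (fg t Pt); unfold Rabs; destruct Rcase_abs; lra.
  - apply (increment_le_of_derive F G f g); eauto.
    intros t Ht; eapply Rle_trans; [apply Rle_abs | eauto]. }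
assert (key' : forall x y, P x -> P y -> Rabs (F y - F x) <= Rabs (G y - G x)).
{ intros x y Px Py; destruct (Rle_dec x y) as [xy|xy].
  - eapply Rle_trans; [apply key; auto | apply Rle_abs].
  - rewrite Rabs_minus_sym, (Rabs_minus_sym (G y)).
    eapply Rle_trans; [apply key; auto; lra | apply Rle_abs]. }
apply (proj1 (filterlim_locally_cauchy (U := R_CompleteSpace) (F := Fil) F)).
intros eps.
assert (HG : exists l, filterlim G Fil (locally l)) by eauto.
apply (proj2 (filterlim_locally_cauchy (U := R_CompleteSpace) (F := Fil) G)) with (eps := eps) in HG.
destruct HG as [Q [FQ HQ]].
exists (fun x => P x /\ Q x); split; [apply filter_and; auto|].
intros u v [Pu Qu] [Pv Qv].
eapply Rle_lt_trans; [apply key'; auto | exact (HQ u v Qu Qv)].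
Qed.

Lemma at_right_0_pos : at_right 0 (fun t => 0 < t).
Proof. exists (mkposreal 1 Rlt_0_1); intros; assumption. Qed.

Lemma p_infty_pos : Rbar_locally p_infty (fun t => 0 < t).
Proof. exists 0; auto. Qed.

Lemma dilation_at_right_0 (c : R) :
  0 < c -> filterlim (fun t => c * t) (at_right 0) (at_right 0).
Proof.
intros c0 P [eps HP].
assert (Hd : 0 < eps / c) by (apply Rdiv_lt_0_compat; [apply eps|auto]).
exists (mkposreal _ Hd); intros y Hy y0.
apply HP; [|nra].
change (Rabs (c * y - 0) < eps); change (Rabs (y - 0) < eps / c) in Hy.
rewrite Rminus_0_r in *; rewrite Rabs_pos_eq in * by nra.
apply (Rmult_lt_compat_l c) in Hy; auto.
replace (c * (eps / c)) with (pos eps) in Hy by (field; lra); auto.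
Qed.

Lemma dilation_p_infty (c : R) :
  0 < c -> filterlim (fun t => c * t) (Rbar_locally p_infty) (Rbar_locally p_infty).
Proof.
intros c0 P [M HM]; exists (M / c); intros x Hx; apply HM.
apply (Rmult_lt_compat_l c) in Hx; auto.
replace (c * (M / c)) with M in Hx by (field; lra); auto.
Qed.

Lemma lim_dilation_at_right_0 (F : R -> R) (c l : R) :
  0 < c -> filterlim F (at_right 0) (locally l) ->
  filterlim (fun t => F (c * t)) (at_right 0) (locally l).
Proof.
intros c0 HF.
exact (filterlim_comp _ _ _ _ _ _ _ _ (dilation_at_right_0 c c0) HF).
Qed.

Lemma lim_dilation_p_infty (F : R -> R) (c l : R) :
  0 < c -> filterlim F (Rbar_locally p_infty) (locally l) ->
  filterlim (fun t => F (c * t)) (Rbar_locally p_infty) (locally l).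
Proof.
intros c0 HF.
exact (filterlim_comp _ _ _ _ _ _ _ _ (dilation_p_infty c c0) HF).
Qed.

Lemma id_at_right_0 : filterlim (fun t : R => t) (at_right 0) (locally 0).
Proof. intros P [eps HP]; exists eps; intros; apply HP; auto. Qed.

Lemma continuous_lim_at_right_0 (f : R -> R) (l : R) :
  continuous f 0 -> f 0 = l -> filterlim f (at_right 0) (locally l).
Proof. intros Hf <-; exact (lim_continuous f _ _ Hf id_at_right_0). Qed.

Lemma inv_p_infty : filterlim Rinv (Rbar_locally p_infty) (locally 0).
Proof. exact (filterlim_Rbar_inv p_infty ltac:(discriminate)). Qed.

Lemma exp_opp_p_infty :
  filterlim (fun t => exp (- t)) (Rbar_locally p_infty) (locally 0).
Proof.
apply (filterlim_comp _ _ _ (fun t => - t) exp _ (Rbar_locally m_infty)).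
- exact (filterlim_Rbar_opp p_infty).
- exact is_lim_exp_m.
Qed.

Lemma lim_squeeze_0 (Fil : (R -> Prop) -> Prop) (FF : Filter Fil) (f g : R -> R) :
  Fil (fun t => Rabs (f t) <= g t) -> filterlim g Fil (locally 0) ->
  filterlim f Fil (locally 0).
Proof.
intros Hfg Hg P [eps HP].
assert (HQ : locally 0 (fun y => Rabs y < eps)).
{ exists eps; intros y Hy; change (Rabs (y - 0) < eps) in Hy.
  now rewrite Rminus_0_r in Hy. }
specialize (Hg _ HQ); unfold filtermap in *.
generalize (filter_and _ _ Hfg Hg); apply filter_imp; intros x [H1 H2].
apply HP; change (Rabs (f x - 0) < eps); rewrite Rminus_0_r.
eapply Rle_lt_trans; [exact H1|]. eapply Rle_lt_trans; [apply Rle_abs | exact H2].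
Qed.

(** The filters stay abstract so that the two integrals in [calC] and the one over the whole
    half-line are all instances. *)
Lemma improper_integral_of_antiderivative (Fa Fb : (R -> Prop) -> Prop)
    (FFa : Filter Fa) (FFb : Filter Fb) (F f : R -> R) (a b : R) :
  Fa (fun t => 0 < t) -> Fb (fun t => 0 < t) ->
  (forall t, 0 < t -> is_derive F t (f t)) ->
  (forall t, 0 < t -> continuous f t) ->
  filterlim F Fa (locally a) -> filterlim F Fb (locally b) ->
  is_RInt_gen f Fa Fb (b - a).
Proof.
intros Pa Pb dF cf la lb.
(* [Derive F] agrees with [f] only on the positive axis, so every interval considered must stay
   there; continuity at [t] is transferred on the ball of radius [t]. *)
apply (is_RInt_gen_ext (Derive F)).
{ econstructor; [exact Pa | exact Pb |].
  intros x y x0 y0 t [Ht _]; apply is_derive_unique, dF; simpl in *.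
  revert Ht; unfold Rmin; destruct Rle_dec; lra. }
apply is_RInt_gen_Derive; auto.
- econstructor; [exact Pa | exact Pb |].
  intros x y x0 y0 t [Ht _]; exists (f t); apply dF; simpl in *.
  revert Ht; unfold Rmin; destruct Rle_dec; lra.
- econstructor; [exact Pa | exact Pb |].
  intros x y x0 y0 t [Ht _]; simpl in *.
  assert (t0 : 0 < t) by (revert Ht; unfold Rmin; destruct Rle_dec; lra).
  apply (continuous_ext_loc _ f); [|auto].
  exists (mkposreal t t0); intros z Hz; symmetry; apply is_derive_unique, dF.
  change (Rabs (z - t) < t) in Hz; apply Rabs_def2 in Hz; lra.
Qed.

(** * Improper integrals on the half-line and Frullani integrals *)

(** Improper integral over the half-line through an antiderivative with limits at both ends.
    Linearity and comparison are then statements about limits, and the passage to [RInt_gen] is made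
    once, for the final integrand. *)
Definition newton_integral (f : R -> R) (l : R) : Prop :=
  exists (F : R -> R) (a b : R),
    (forall t, 0 < t -> is_derive F t (f t)) /\
    filterlim F (at_right 0) (locally a) /\
    filterlim F (Rbar_locally p_infty) (locally b) /\ l = b - a.

Lemma newton_integral_intro (F f : R -> R) (a b : R) :
  (forall t, 0 < t -> is_derive F t (f t)) ->
  filterlim F (at_right 0) (locally a) ->
  filterlim F (Rbar_locally p_infty) (locally b) ->
  newton_integral f (b - a).
Proof. intros; exists F, a, b; auto. Qed.

Lemma newton_integral_ext (f g : R -> R) (l : R) :
  (forall t, 0 < t -> f t = g t) -> newton_integral f l -> newton_integral g l.
Proof.
intros fg (F & a & b & dF & Fa & Fb & ->); apply newton_integral_intro with F; auto.
intros t t0; rewrite <- fg; auto.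
Qed.

Lemma newton_integral_plus (f g : R -> R) (k l : R) :
  newton_integral f k -> newton_integral g l ->
  newton_integral (fun t => f t + g t) (k + l).
Proof.
intros (F & a & b & dF & Fa & Fb & ->) (G & c & d & dG & Gc & Gd & ->).
replace (b - a + (d - c)) with ((b + d) - (a + c)) by ring.
apply newton_integral_intro with (fun t => F t + G t).
- intros t t0; apply (is_derive_plus F G); auto.
- apply lim_plus; auto.
- apply lim_plus; auto.
Qed.

Lemma newton_integral_scal (f : R -> R) (k l : R) :
  newton_integral f l -> newton_integral (fun t => k * f t) (k * l).
Proof.
intros (F & a & b & dF & Fa & Fb & ->).
replace (k * (b - a)) with (k * b - k * a) by ring.
apply newton_integral_intro with (fun t => k * F t).
- intros t t0; apply (is_derive_scal F); auto.
- apply lim_scal; auto.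
- apply lim_scal; auto.
Qed.

Lemma newton_integral_minus (f g : R -> R) (k l : R) :
  newton_integral f k -> newton_integral g l ->
  newton_integral (fun t => f t - g t) (k - l).
Proof.
intros Hf Hg; replace (k - l) with (k + -1 * l) by ring.
apply newton_integral_ext with (fun t => f t + -1 * g t); [intros; ring|].
apply newton_integral_plus; auto; apply newton_integral_scal; auto.
Qed.

Lemma newton_integral_zero : newton_integral (fun _ => 0) 0.
Proof.
assert (H := newton_integral_intro (fun _ => 0) (fun _ => 0) 0 0).
rewrite Rminus_0_r in H; apply H.
- intros; exact (is_derive_const 0 t).
- apply filterlim_const.
- apply filterlim_const.
Qed.

(** [G - F] is nondecreasing, so its value at 1 separates its limit at 0 from its limit at
    infinity. *)
Lemma newton_integral_le (f g : R -> R) (k l : R) :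
  (forall t, 0 < t -> f t <= g t) ->
  newton_integral f k -> newton_integral g l -> k <= l.
Proof.
intros fg (F & a & b & dF & Fa & Fb & ->) (G & c & d & dG & Gc & Gd & ->).
assert (mono : forall x y, 0 < x -> x <= y -> G x - F x <= G y - F y).
{ intros x y x0 xy.
  assert (H : F y - F x <= G y - G x); [|lra].
  apply increment_le_of_derive with f g; auto; intros t Ht;
    [apply dF | apply dG | apply fg]; lra. }
assert (Rbar_le (c - a) (G 1 - F 1)).
{ apply (filterlim_le (F := at_right 0) (fun t => G t - F t) (fun _ => G 1 - F 1)).
  - exists (mkposreal 1 Rlt_0_1); intros y Hy y0; apply mono; auto.
    change (Rabs (y - 0) < 1) in Hy; apply Rabs_def2 in Hy; lra.
  - exact (lim_minus _ _ _ _ Gc Fa).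
  - apply filterlim_const. }
assert (Rbar_le (G 1 - F 1) (d - b)).
{ apply (filterlim_le (F := Rbar_locally p_infty) (fun _ => G 1 - F 1) (fun t => G t - F t)).
  - exists 1; intros y Hy; apply mono; lra.
  - apply filterlim_const.
  - exact (lim_minus _ _ _ _ Gd Fb). }
simpl in *; lra.
Qed.

Lemma is_derive_RInt_from_1 (f : R -> R) (x : R) :
  (forall t, 0 < t -> continuous f t) -> 0 < x ->
  is_derive (fun y => RInt f 1 y) x (f x).
Proof.
intros cf x0; apply (is_derive_RInt f (fun y => RInt f 1 y) 1 x); [|auto].
exists (mkposreal x x0); intros y Hy.
change (Rabs (y - x) < x) in Hy; apply Rabs_def2 in Hy.
apply (RInt_correct (V := R_CompleteNormedModule)).
apply (ex_RInt_continuous (V := R_CompleteNormedModule)); intros z [Hz _]; apply cf.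
revert Hz; unfold Rmin; destruct Rle_dec; lra.
Qed.

(** In terms of the exponential integral this is [E_1(1) - E_1(x)]. Below, [e0] is the limit at 0
    after removal of [ln x] and [e1] the limit at infinity; only [e0 - e1] matters, and it turns out
    to be Euler's constant. *)
Definition expint_primitive (x : R) : R := RInt (fun t => exp (- t) / t) 1 x.

Lemma is_derive_expint (x : R) : 0 < x -> is_derive expint_primitive x (exp (- x) / x).
Proof.
intros x0; apply (is_derive_RInt_from_1 (fun t => exp (- t) / t)); auto.
intros t t0; apply (ex_derive_continuous (fun t => exp (- t) / t)).
auto_derive; lra.
Qed.

Lemma is_derive_expint_dilation (c x : R) :
  0 < c -> 0 < x -> is_derive (fun t => expint_primitive (c * t)) x (exp (- (c * x)) / x).
Proof.
intros c0 x0.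
evar_last.
- apply (is_derive_comp expint_primitive (fun t => c * t)).
  + apply is_derive_expint; nra.
  + auto_derive; auto.
- unfold scal; simpl; unfold mult; simpl; field; lra.
Qed.

(** The derivative of the difference is [-(1 - e^{-t})/t], bounded by 1 in absolute value since
    [1 - t <= e^{-t}]; the dominating primitive is [t] itself. *)
Lemma expint_primitive_at_0 :
  exists e0, filterlim (fun x => expint_primitive x - ln x) (at_right 0) (locally e0).
Proof.
apply (ex_limit_of_dominated (at_right 0) _ (fun t => 0 < t)
  _ (fun t => t) (fun t => exp (- t) / t - / t) (fun _ => 1) 0).
- exact at_right_0_pos.
- intros; lra.
- intros t t0; apply (is_derive_minus expint_primitive ln); [apply is_derive_expint; auto|].
  auto_derive; [auto | field; lra].
- intros; apply (is_derive_id t).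
- intros t t0.
  replace (exp (- t) / t - / t) with (- ((1 - exp (- t)) / t)) by (field; lra).
  assert (exp (- t) < 1) by (rewrite <- exp_0; apply exp_increasing; lra).
  generalize (exp_ineq1_le (- t)); intros.
  rewrite Rabs_Ropp, Rabs_pos_eq.
  + apply (Rmult_le_reg_r t); auto; field_simplify; lra.
  + apply Rlt_le, Rdiv_lt_0_compat; lra.
- exact id_at_right_0.
Qed.

Lemma expint_primitive_at_infty :
  exists e1, filterlim expint_primitive (Rbar_locally p_infty) (locally e1).
Proof.
apply (ex_limit_of_dominated (Rbar_locally p_infty) _ (fun t => 1 < t)
  _ (fun t => - exp (- t)) (fun t => exp (- t) / t) (fun t => exp (- t)) (- 0)).
- exists 1; auto.
- intros; lra.
- intros t t0; apply is_derive_expint; lra.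
- intros; auto_derive; [auto | ring].
- intros t t1; generalize (exp_pos (- t)); intros.
  rewrite Rabs_pos_eq.
  + apply (Rmult_le_reg_r t); [lra|]; field_simplify; nra.
  + apply Rlt_le, Rdiv_lt_0_compat; lra.
- apply (filterlim_ext (fun t => -1 * exp (- t))); [intros; ring|].
  replace (- 0) with (-1 * 0) by ring.
  apply lim_scal, exp_opp_p_infty.
Qed.

(** The primitive is a difference of two dilations of [expint_primitive]. At infinity the two limits
    cancel; at 0 the constants [e0] and the terms [ln t] cancel, and [ln a - ln b] remains. *)
Lemma frullani_exp (a b : R) :
  0 < a -> 0 < b ->
  newton_integral (fun t => (exp (- (a * t)) - exp (- (b * t))) / t) (ln b - ln a).
Proof.
intros a0 b0.
destruct expint_primitive_at_0 as [e0 H0]; destruct expint_primitive_at_infty as [e1 H1].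
replace (ln b - ln a) with ((e1 - e1) - ((e0 - e0) + (ln a - ln b))) by ring.
apply newton_integral_intro with (fun t => expint_primitive (a * t) - expint_primitive (b * t)).
- intros t t0; evar_last.
  + apply (is_derive_minus (fun t => expint_primitive (a * t)) (fun t => expint_primitive (b * t)));
      apply is_derive_expint_dilation; auto.
  + unfold minus, plus, opp; simpl; field; lra.
- apply (filterlim_ext_loc (fun t => (expint_primitive (a * t) - ln (a * t))
      - (expint_primitive (b * t) - ln (b * t)) + (ln a - ln b))).
  + generalize at_right_0_pos; apply filter_imp; intros t t0.
    rewrite !ln_mult by auto; ring.
  + apply lim_plus; [|apply filterlim_const].
    apply lim_minus; apply (lim_dilation_at_right_0 (fun t => expint_primitive t - ln t)); auto.
- apply lim_minus; apply lim_dilation_p_infty; auto.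
Qed.

Lemma newton_integral_exp (c : R) :
  0 < c -> newton_integral (fun t => exp (- (c * t))) (/ c).
Proof.
intros c0; replace (/ c) with (- / c * 0 - - / c * exp (- (c * 0)))
  by (rewrite !Rmult_0_r, Ropp_0, exp_0; ring).
apply newton_integral_intro with (fun t => - / c * exp (- (c * t))).
- intros t t0; auto_derive; [auto | field; lra].
- apply lim_scal, continuous_lim_at_right_0; [|reflexivity].
  apply (ex_derive_continuous (fun t => exp (- (c * t)))); auto_derive; auto.
- apply lim_scal, (lim_dilation_p_infty (fun t => exp (- t))); auto.
  apply exp_opp_p_infty.
Qed.

(** * Wallis' product *)

Definition sin_pow_integral (n : nat) : R := RInt (fun x => sin x ^ n) 0 (PI / 2).

Lemma ex_RInt_sin_pow (n : nat) : ex_RInt (fun x => sin x ^ n) 0 (PI / 2).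
Proof.
apply (ex_RInt_continuous (V := R_CompleteNormedModule)); intros z _.
apply (ex_derive_continuous (fun x => sin x ^ n)); auto_derive; auto.
Qed.

(** [-cos x sin^{n+1} x] vanishes at both ends, and its derivative is
    [(n+2) sin^{n+2} x - (n+1) sin^n x]. *)
Lemma sin_pow_integral_rec (n : nat) :
  (INR n + 2) * sin_pow_integral (n + 2) = (INR n + 1) * sin_pow_integral n.
Proof.
assert (Hl : is_RInt (fun x => minus (scal (INR n + 2) (sin x ^ (n + 2)))
    (scal (INR n + 1) (sin x ^ n))) 0 (PI / 2)
  (minus (scal (INR n + 2) (sin_pow_integral (n + 2)))
    (scal (INR n + 1) (sin_pow_integral n)))).
{ apply (is_RInt_minus (V := R_NormedModule)); apply (is_RInt_scal (V := R_NormedModule));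
    apply (RInt_correct (V := R_CompleteNormedModule)), ex_RInt_sin_pow. }
assert (Hd : is_RInt (fun x => minus (scal (INR n + 2) (sin x ^ (n + 2)))
    (scal (INR n + 1) (sin x ^ n))) 0 (PI / 2)
  (minus (- cos (PI / 2) * sin (PI / 2) ^ (n + 1)) (- cos 0 * sin 0 ^ (n + 1)))).
{ apply (is_RInt_derive (fun x => - cos x * sin x ^ (n + 1))).
  - intros x _; auto_derive; auto.
    replace (Init.Nat.pred (n + 1)) with n by lia.
    rewrite !pow_add, plus_INR.
    change (minus (scal (INR n + 2) (sin x ^ n * sin x ^ 2)) (scal (INR n + 1) (sin x ^ n)))
      with ((INR n + 2) * (sin x ^ n * sin x ^ 2) + - ((INR n + 1) * sin x ^ n)).
    generalize (sin2_cos2 x); unfold Rsqr; intros H.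
    replace (- cos x * (1 * cos x * ((INR n + INR 1) * sin x ^ n))) with
      (- (cos x * cos x) * (INR n + INR 1) * sin x ^ n) by ring.
    replace (cos x * cos x) with (1 - sin x * sin x) by lra; simpl; ring.
  - intros x _.
    apply (ex_derive_continuous (fun x => (INR n + 2) * sin x ^ (n + 2)
      - (INR n + 1) * sin x ^ n)); auto_derive; auto. }
assert (E := eq_trans (eq_sym (is_RInt_unique _ _ _ _ Hl)) (is_RInt_unique _ _ _ _ Hd)).
rewrite cos_PI2, sin_0, (pow_ne_zero (n + 1)) in E by lia.
revert E; unfold minus, plus, opp, scal; simpl; unfold mult; simpl; lra.
Qed.

Lemma sin_pow_integral_0 : sin_pow_integral 0 = PI / 2.
Proof.
unfold sin_pow_integral; simpl; rewrite RInt_const.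
unfold scal; simpl; unfold mult; simpl; lra.
Qed.

Lemma sin_pow_integral_1 : sin_pow_integral 1 = 1.
Proof.
apply is_RInt_unique.
replace 1 with (minus (- cos (PI / 2)) (- cos 0))
  by (rewrite cos_PI2, cos_0; unfold minus, plus, opp; simpl; ring).
apply (is_RInt_derive (fun x => - cos x)).
- intros x _; auto_derive; auto; ring.
- intros x _; apply (ex_derive_continuous (fun x => sin x ^ 1)); auto_derive; auto.
Qed.

Lemma sin_pow_integral_pos (n : nat) : 0 < sin_pow_integral n.
Proof.
(* The recurrence advances by two, so two consecutive values are carried through the induction. *)
enough (H : 0 < sin_pow_integral n /\ 0 < sin_pow_integral (S n)) by apply H.
induction n as [|n [IH1 IH2]].
- rewrite sin_pow_integral_0, sin_pow_integral_1; generalize PI_RGT_0; lra.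
- split; auto.
  generalize (sin_pow_integral_rec n) (pos_INR n); replace (n + 2)%nat with (S (S n)) by lia.
  intros E Hn.
  apply (Rmult_lt_reg_l (INR n + 2)); [lra|]; rewrite Rmult_0_r, E; nra.
Qed.

Lemma sin_pow_integral_decr (n : nat) : sin_pow_integral (S n) <= sin_pow_integral n.
Proof.
apply RInt_le; try apply ex_RInt_sin_pow; [generalize PI_RGT_0; lra|].
intros x Hx; simpl.
assert (0 <= sin x) by (apply sin_ge_0; lra).
generalize (pow_le (sin x) n H) (SIN_bound x); nra.
Qed.

(** By the recurrence at [2N] and [2N+1], the ratio of the integrals of index [2N+1] and [2N] is
    multiplied by [(2N+2)^2 / ((2N+1)(2N+3))] when [N] increases by one. The offset [ln (PI / 2)]
    comes from the initial ratio [2 / PI]. *)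
Lemma wallis_partial (N : nat) :
  sum_n_m (fun i => 2 * ln (2 * INR i) - ln (2 * INR i - 1) - ln (2 * INR i + 1)) 1 N
  = ln (sin_pow_integral (2 * N + 1)) - ln (sin_pow_integral (2 * N)) + ln (PI / 2).
Proof.
induction N as [|N IH].
- rewrite sum_n_m_zero by lia.
  change (2 * 0 + 1)%nat with 1%nat; change (2 * 0)%nat with 0%nat.
  rewrite sin_pow_integral_0, sin_pow_integral_1, ln_1; unfold zero; simpl; lra.
- rewrite sum_n_m_Sr by lia; rewrite IH, S_INR.
  generalize (sin_pow_integral_rec (2 * N)) (sin_pow_integral_rec (2 * N + 1)).
  replace (2 * N + 2)%nat with (2 * S N)%nat by lia.
  replace (2 * N + 1 + 2)%nat with (2 * S N + 1)%nat by lia.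
  rewrite plus_INR, mult_INR; change (INR 2) with 2; change (INR 1) with 1.
  generalize (sin_pow_integral_pos (2 * N)) (sin_pow_integral_pos (2 * N + 1))
    (sin_pow_integral_pos (2 * S N)) (sin_pow_integral_pos (2 * S N + 1)).
  intros P1 P2 P3 P4 E1 E2; generalize (pos_INR N); intros HN.
  apply (f_equal ln) in E1; apply (f_equal ln) in E2.
  rewrite !ln_mult in E1, E2 by lra.
  replace (2 * (INR N + 1) - 1) with (2 * INR N + 1) by ring.
  replace (2 * (INR N + 1) + 1) with (2 * INR N + 1 + 2) by ring.
  replace (2 * (INR N + 1)) with (2 * INR N + 2) by ring.
  replace (2 * INR N + 1 + 1) with (2 * INR N + 2) in E2 by ring.
  lra.
Qed.

Lemma wallis :
  is_lim_seq (fun N => sum_n_m (fun i =>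
    2 * ln (2 * INR i) - ln (2 * INR i - 1) - ln (2 * INR i + 1)) 1 N) (ln (PI / 2)).
Proof.
apply is_lim_seq_ext with (fun N => ln (sin_pow_integral (2 * N + 1)
  / sin_pow_integral (2 * N)) + ln (PI / 2)).
{ intros N; rewrite wallis_partial, ln_div; [ring|..].
  - apply sin_pow_integral_pos.
  - apply sin_pow_integral_pos. }
replace (Finite (ln (PI / 2))) with (Finite (ln 1 + ln (PI / 2)))
  by (rewrite ln_1; f_equal; ring).
apply is_lim_seq_plus'; [|apply is_lim_seq_const].
apply is_lim_seq_continuous.
{ apply continuity_pt_filterlim, (ex_derive_continuous ln); auto_derive; lra. }
(* The integrals decrease with the exponent, so the ratio lies between
   [(2N+1)/(2N+2) = 1 - 1/(2N+2)] and 1; the lower bound is relaxed to [1 - 1/(N+1)]. *)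
apply is_lim_seq_le_le with (fun N => 1 - / INR (N + 1)) (fun _ => 1).
- intros N.
  generalize (sin_pow_integral_rec (2 * N)) (sin_pow_integral_decr (2 * N))
    (sin_pow_integral_decr (2 * N + 1)) (sin_pow_integral_pos (2 * N))
    (sin_pow_integral_pos (2 * N + 1)) (pos_INR N).
  rewrite mult_INR, plus_INR; change (INR 2) with 2; change (INR 1) with 1.
  replace (S (2 * N + 1)) with (2 * N + 2)%nat by lia.
  replace (S (2 * N)) with (2 * N + 1)%nat by lia.
  intros E D1 D2 P1 P2 HN; split.
  + apply Rle_div_r; auto.
    assert (E' : sin_pow_integral (2 * N + 2)
        = (1 - / (INR N + 1) / 2) * sin_pow_integral (2 * N)).
    { apply (Rmult_eq_reg_l (2 * INR N + 2)); [rewrite E; field|]; lra. }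
    assert (0 < / (INR N + 1)) by (apply Rinv_0_lt_compat; lra).
    nra.
  + apply (Rmult_le_reg_r (sin_pow_integral (2 * N))); auto; field_simplify; lra.
- replace (Finite 1) with (Finite (1 - 0)) by (f_equal; ring).
  apply is_lim_seq_minus'; [apply is_lim_seq_const|].
  apply (is_lim_seq_incr_n (fun n => / INR n) 1).
  apply (is_lim_seq_inv _ p_infty); [apply is_lim_seq_INR | discriminate].
- apply is_lim_seq_const.
Qed.

(** * Euler's constant *)

Lemma expm1_pos (t : R) : 0 < t -> t < exp t - 1.
Proof. intros t0; generalize (exp_ineq1 t); lra. Qed.

Lemma ln_1_minus_exp_at_0 :
  filterlim (fun t => ln (1 - exp (- t)) - ln t) (at_right 0) (locally 0).
Proof.
apply (filterlim_ext_loc (fun t => ln ((exp t - 1) / t) - t)).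
- generalize at_right_0_pos; apply filter_imp; intros t t0.
  generalize (expm1_pos t t0); intros H.
  replace (1 - exp (- t)) with (exp (- t) * (exp t - 1))
    by (rewrite Rmult_minus_distr_l, <- exp_plus, Rplus_opp_l, exp_0; ring).
  rewrite ln_mult, ln_exp, ln_div by (try apply exp_pos; lra); ring.
- assert (E : ln 1 - 0 = 0) by (rewrite ln_1; ring); rewrite <- E at 2.
  apply lim_minus; [|exact id_at_right_0].
  apply (lim_continuous ln).
  + apply (ex_derive_continuous ln); auto_derive; lra.
  + intros P HP; destruct (is_lim_div_expm1_0 P HP) as [eps H].
    exists eps; intros y Hy y0; apply H; auto; lra.
Qed.

Lemma ln_1_minus_exp_at_infty :
  filterlim (fun t => ln (1 - exp (- t))) (Rbar_locally p_infty) (locally 0).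
Proof.
rewrite <- ln_1; apply (lim_continuous ln).
- apply (ex_derive_continuous ln); auto_derive; lra.
- assert (H := lim_minus _ _ _ _ (filterlim_const 1) exp_opp_p_infty).
  rewrite Rminus_0_r in H; exact H.
Qed.

Lemma is_derive_ln_1_minus_exp (t : R) :
  0 < t -> is_derive (fun t => ln (1 - exp (- t))) t (/ (exp t - 1)).
Proof.
intros t0; generalize (expm1_pos t t0); intros H.
assert (exp (- t) < 1) by (rewrite <- exp_0; apply exp_increasing; lra).
auto_derive; [lra|].
rewrite exp_Ropp in *; field; split; lra.
Qed.

(** [ln (1 - e^{-t})] is a primitive of [1/(e^t - 1)] and behaves like [ln t] at 0, so its
    singularity cancels that of [expint_primitive]. *)
Lemma gamma_integrand_integral (e0 e1 : R) :
  filterlim (fun x => expint_primitive x - ln x) (at_right 0) (locally e0) ->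
  filterlim expint_primitive (Rbar_locally p_infty) (locally e1) ->
  newton_integral (fun t => / (exp t - 1) - exp (- t) / t) (e0 - e1).
Proof.
intros H0 H1; replace (e0 - e1) with ((0 - e1) - (0 - e0)) by ring.
apply newton_integral_intro with (fun t => ln (1 - exp (- t)) - expint_primitive t).
- intros t t0; apply (is_derive_minus (fun t => ln (1 - exp (- t))) expint_primitive).
  + apply is_derive_ln_1_minus_exp; auto.
  + apply is_derive_expint; auto.
- apply (filterlim_ext (fun t => (ln (1 - exp (- t)) - ln t) - (expint_primitive t - ln t)));
    [intros; ring|].
  apply lim_minus; auto; exact ln_1_minus_exp_at_0.
- apply lim_minus; auto; exact ln_1_minus_exp_at_infty.
Qed.

Lemma newton_integral_sum (f : nat -> R -> R) (l : nat -> R) (a b : nat) :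
  (forall k, (a <= k <= b)%nat -> newton_integral (f k) (l k)) ->
  newton_integral (fun t => sum_n_m (fun k => f k t) a b) (sum_n_m l a b).
Proof.
induction b as [|b IH]; intros Hf.
- destruct a as [|a].
  + rewrite sum_n_n; apply newton_integral_ext with (f 0%nat); [|apply Hf; lia].
    intros; rewrite sum_n_n; auto.
  + rewrite sum_n_m_zero by lia.
    apply newton_integral_ext with (fun _ => 0); [|exact newton_integral_zero].
    intros; rewrite sum_n_m_zero by lia; auto.
- destruct (Nat.le_gt_cases a (S b)) as [ab|ab].
  + rewrite sum_n_m_Sr by lia.
    apply newton_integral_ext with (fun t => sum_n_m (fun k => f k t) a b + f (S b) t).
    { intros; rewrite sum_n_m_Sr by lia; auto. }
    apply newton_integral_plus; [apply IH; intros; apply Hf; lia | apply Hf; lia].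
  + rewrite sum_n_m_zero by lia.
    apply newton_integral_ext with (fun _ => 0); [|exact newton_integral_zero].
    intros; rewrite sum_n_m_zero by lia; auto.
Qed.

Lemma sum_exp (N : nat) (t : R) :
  0 < t ->
  (1 - exp (- (INR N * t))) / (exp t - 1) = sum_n_m (fun k => exp (- (INR k * t))) 1 N.
Proof.
intros t0; generalize (expm1_pos t t0); intros H; induction N as [|N IH].
- rewrite sum_n_m_zero by lia; simpl; rewrite Rmult_0_l, Ropp_0, exp_0.
  unfold zero; simpl; field; lra.
- rewrite sum_n_m_Sr, <- IH, S_INR by lia.
  replace (- (INR N * t)) with (- ((INR N + 1) * t) + t) by ring.
  rewrite exp_plus; field; lra.
Qed.

(** Each [1/k] is the integral of [e^{-kt}], summed geometrically, and [ln N] is a Frullani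
    integral; the approximants of Euler's constant thus become single integrals, ready for
    comparison. *)
Lemma harmonic_minus_ln_integral (N : nat) :
  (1 <= N)%nat ->
  newton_integral (fun t => (1 - exp (- (INR N * t))) / (exp t - 1)
      - (exp (- (1 * t)) - exp (- (INR N * t))) / t)
    (sum_n_m (fun k => / INR k) 1 N - (ln (INR N) - ln 1)).
Proof.
intros HN; assert (0 < INR N) by (apply lt_0_INR; lia).
apply newton_integral_minus; [|apply frullani_exp; lra].
apply newton_integral_ext with (fun t => sum_n_m (fun k => exp (- (INR k * t))) 1 N).
{ intros; symmetry; apply sum_exp; auto. }
apply newton_integral_sum; intros k Hk; apply newton_integral_exp, lt_0_INR; lia.
Qed.

(** The bounded quantity is [t] times [calC_integrand_0_1 t]. This controls the behaviour at 0 of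
    [1/(e^t - 1)], whose expansion starts with [1/t - 1/2]. *)
Lemma bose_bounds (t : R) :
  0 < t -> 0 <= / (exp t - 1) - / t + / 2 <= t / 2.
Proof.
intros t0; generalize (expm1_pos t t0); intros H1.
assert (H2 : t + t ^ 2 / 2 <= exp t - 1).
{ assert (K : (t + t ^ 2 / 2) - (0 + 0 ^ 2 / 2) <= exp t - exp 0);
    [|rewrite exp_0 in K; lra].
  apply (increment_le_of_derive (fun t => t + t ^ 2 / 2) exp (fun t => 1 + t) exp); try lra.
  - intros u _; auto_derive; auto; field.
  - intros u _; auto_derive; auto; ring.
  - intros u _; apply exp_ineq1_le. }
(* This is the lower bound multiplied by [2t(e^t - 1)]. It vanishes at 0, and its derivative
   [t e^t - e^t + 1] is nonnegative because [e^{-t} >= 1 - t]. *)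
assert (H3 : 0 <= t * exp t + t - 2 * exp t + 2).
{ assert (K : 0 - 0 <= (t * exp t + t - 2 * exp t + 2) - (0 * exp 0 + 0 - 2 * exp 0 + 2));
    [|rewrite exp_0 in K; lra].
  apply (increment_le_of_derive (fun t => 0) (fun t => t * exp t + t - 2 * exp t + 2)
    (fun t => 0) (fun t => t * exp t - exp t + 1)); try lra.
  - intros u _; auto_derive; auto.
  - intros u _; auto_derive; auto; ring.
  - intros u _; generalize (exp_ineq1_le (- u)) (exp_pos u); rewrite exp_Ropp; intros A B.
    apply (Rmult_le_compat_r (exp u)) in A; [|lra].
    rewrite Rinv_l in A by lra; lra. }
assert (H4 : 0 < t * (exp t - 1)) by nra.
split.
- apply (Rmult_le_reg_r (t * (exp t - 1))); auto; field_simplify; nra.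
- apply (Rmult_le_reg_r (t * (exp t - 1))); auto; field_simplify; [|lra].
  (* Cleared of denominators, the upper bound reads [t <= (e^t - 1)(1 - t/2 + t^2/2)]. With [H2] the
     right side is at least [t + t^3/4 + t^4/4]. *)
  assert (t * (t + t ^ 2 / 2) * (1 - t / 2 + t ^ 2 / 2)
    <= t * (exp t - 1) * (1 - t / 2 + t ^ 2 / 2)).
  { apply Rmult_le_compat_r; nra. }
  assert (0 < t ^ 4) by (apply pow_lt; auto).
  nra.
Qed.

(** [H_N - ln N] exceeds [e0 - e1] by the integral of [e^{-Nt} (1/t - 1/(e^t - 1))]. The bracket
    lies between 0 and 1, so the excess is between 0 and [1/N]. This also shows that the limit
    defining [euler_gamma] exists. *)
Lemma euler_gamma_eq (e0 e1 : R) :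
  filterlim (fun x => expint_primitive x - ln x) (at_right 0) (locally e0) ->
  filterlim expint_primitive (Rbar_locally p_infty) (locally e1) ->
  euler_gamma = e0 - e1.
Proof.
intros H0 H1; assert (Hg := gamma_integrand_integral e0 e1 H0 H1).
unfold euler_gamma; rewrite (is_lim_seq_unique _ (e0 - e1)); auto.
apply is_lim_seq_le_le_loc with (fun _ => e0 - e1) (fun N => (e0 - e1) + / INR N).
- exists 1%nat; intros N HN.
  assert (N0 : 0 < INR N) by (apply lt_0_INR; lia).
  assert (HS := harmonic_minus_ln_integral N HN); rewrite ln_1, Rminus_0_r in HS.
  split.
  + apply (newton_integral_le _ _ _ _) with (2 := Hg) (3 := HS); intros t t0.
    rewrite Rmult_1_l; generalize (expm1_pos t t0) (exp_pos (- (INR N * t))); intros A B.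
    assert (/ (exp t - 1) < / t) by (apply Rinv_lt_contravar; nra).
    unfold Rdiv; nra.
  + apply (newton_integral_le _ _ _ _) with (2 := HS)
      (3 := newton_integral_plus _ _ _ _ Hg (newton_integral_exp _ N0)); intros t t0.
    rewrite Rmult_1_l; generalize (bose_bounds t t0) (exp_pos (- (INR N * t))); intros A B.
    unfold Rdiv; nra.
- apply is_lim_seq_const.
- replace (Finite (e0 - e1)) with (Finite ((e0 - e1) + 0)) by (f_equal; ring).
  apply is_lim_seq_plus'; [apply is_lim_seq_const|].
  apply (is_lim_seq_inv _ p_infty); [apply is_lim_seq_INR | discriminate].
Qed.

(** * The value of calC *)

(** At 0 it behaves like [-1/x - (ln x)/2 + g0], and at infinity it tends to [g1]. Adding
    [1/x + (ln x)/2] gives a primitive of [calC_integrand_0_1], which is how both integrals in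
    [calC] come from this one function. *)
Definition bose_primitive (x : R) : R := RInt calC_integrand_1_infty 1 x.

Lemma continuous_calC_integrand_1_infty (t : R) :
  0 < t -> continuous calC_integrand_1_infty t.
Proof.
intros t0; generalize (expm1_pos t t0); intros H.
apply (ex_derive_continuous calC_integrand_1_infty); unfold calC_integrand_1_infty.
auto_derive; nra.
Qed.

Lemma continuous_calC_integrand_0_1 (t : R) :
  0 < t -> continuous calC_integrand_0_1 t.
Proof.
intros t0; generalize (expm1_pos t t0); intros H.
apply (ex_derive_continuous calC_integrand_0_1); unfold calC_integrand_0_1.
auto_derive; repeat split; nra.
Qed.

Lemma is_derive_bose_primitive (x : R) : 0 < x -> is_derive bose_primitive x (calC_integrand_1_infty x).
Proof.
intros x0; apply is_derive_RInt_from_1; auto.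
exact continuous_calC_integrand_1_infty.
Qed.

Lemma is_derive_bose_primitive_dilation (c x : R) :
  0 < c -> 0 < x ->
  is_derive (fun t => bose_primitive (c * t)) x (/ (x * (exp (c * x) - 1))).
Proof.
intros c0 x0; assert (cx : 0 < c * x) by nra.
generalize (expm1_pos _ cx); intros H.
evar_last.
- apply (is_derive_comp bose_primitive (fun t => c * t)).
  + apply is_derive_bose_primitive; auto.
  + auto_derive; auto.
- unfold scal; simpl; unfold mult; simpl; unfold calC_integrand_1_infty.
  field; repeat split; lra.
Qed.

Lemma is_derive_bose_primitive_regularized (t : R) :
  0 < t -> is_derive (fun x => bose_primitive x + (/ x + ln x / 2)) t (calC_integrand_0_1 t).
Proof.
intros t0; generalize (expm1_pos t t0); intros H; evar_last.
- apply (is_derive_plus bose_primitive (fun x => / x + ln x / 2)).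
  + apply is_derive_bose_primitive; auto.
  + auto_derive; [split; [lra | auto] | reflexivity].
- unfold calC_integrand_0_1, calC_integrand_1_infty, plus; simpl.
  field; lra.
Qed.

Lemma bose_primitive_at_0 :
  exists g0, filterlim (fun x => bose_primitive x + (/ x + ln x / 2)) (at_right 0) (locally g0).
Proof.
apply (ex_limit_of_dominated (at_right 0) _ (fun t => 0 < t)
  _ (fun t => / 2 * t) calC_integrand_0_1 (fun _ => / 2) (/ 2 * 0)).
- exact at_right_0_pos.
- intros; lra.
- exact is_derive_bose_primitive_regularized.
- intros; auto_derive; auto; ring.
- intros t t0; generalize (bose_bounds t t0) (expm1_pos t t0); intros [H1 H2] H3.
  replace (calC_integrand_0_1 t) with ((/ (exp t - 1) - / t + / 2) / t)
    by (unfold calC_integrand_0_1; field; lra).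
  rewrite Rabs_pos_eq.
  + apply (Rle_div_l _ _ _ t0); lra.
  + apply (Rle_div_r _ _ _ t0); lra.
- apply lim_scal, id_at_right_0.
Qed.

Lemma bose_primitive_at_infty :
  exists g1, filterlim bose_primitive (Rbar_locally p_infty) (locally g1).
Proof.
apply (ex_limit_of_dominated (Rbar_locally p_infty) _ (fun t => 0 < t)
  _ (fun t => -1 * / t) calC_integrand_1_infty (fun t => / t ^ 2) (-1 * 0)).
- exact p_infty_pos.
- intros; lra.
- exact is_derive_bose_primitive.
- intros t t0; auto_derive; [lra | field; lra].
- intros t t0; generalize (expm1_pos t t0); intros H; unfold calC_integrand_1_infty.
  assert (t * t < t * (exp t - 1)) by nra.
  rewrite Rabs_pos_eq.
  + apply Rinv_le_contravar; simpl; nra.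
  + apply Rlt_le, Rinv_0_lt_compat; nra.
- apply lim_scal, inv_p_infty.
Qed.

(** The regularized primitive equals 1 at the point 1, because of the term [1/x]. This is the 1 that
    leads the definition of [calC], which therefore reduces to [g0 - g1]. *)
Lemma calC_integrals (g0 g1 : R) :
  filterlim (fun x => bose_primitive x + (/ x + ln x / 2)) (at_right 0) (locally g0) ->
  filterlim bose_primitive (Rbar_locally p_infty) (locally g1) ->
  is_RInt_gen calC_integrand_0_1 (at_right 0) (at_point 1) (1 - g0) /\
  is_RInt_gen calC_integrand_1_infty (at_point 1) (Rbar_locally p_infty) g1.
Proof.
intros H0 H1.
assert (P1 : bose_primitive 1 = 0) by (unfold bose_primitive; rewrite RInt_point; reflexivity).
assert (at_1 : at_point 1 (fun t => 0 < t)) by exact Rlt_0_1.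
split.
- apply (improper_integral_of_antiderivative (at_right 0) (at_point 1) _ _
    (fun x => bose_primitive x + (/ x + ln x / 2))); auto.
  + exact at_right_0_pos.
  + exact is_derive_bose_primitive_regularized.
  + exact continuous_calC_integrand_0_1.
  + intros Q HQ; apply (locally_singleton _ _) in HQ; unfold filtermap, at_point.
    rewrite P1, ln_1; replace (0 + (/ 1 + 0 / 2)) with 1 by field; auto.
- rewrite <- (Rminus_0_r g1).
  apply (improper_integral_of_antiderivative (at_point 1) (Rbar_locally p_infty) _ _ bose_primitive); auto.
  + exact p_infty_pos.
  + exact is_derive_bose_primitive.
  + exact continuous_calC_integrand_1_infty.
  + intros Q HQ; apply (locally_singleton _ _) in HQ; unfold filtermap, at_point.
    rewrite P1; auto.
Qed.

Lemma calC_eq (g0 g1 : R) :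
  filterlim (fun x => bose_primitive x + (/ x + ln x / 2)) (at_right 0) (locally g0) ->
  filterlim bose_primitive (Rbar_locally p_infty) (locally g1) ->
  calC = g0 - g1.
Proof.
intros H0 H1; destruct (calC_integrals g0 g1 H0 H1) as [I0 I1].
unfold calC; rewrite (is_RInt_gen_unique _ _ I0), (is_RInt_gen_unique _ _ I1); ring.
Qed.

(** By [1/(e^t+1) = 1/(e^t-1) - 2/(e^{2t}-1)], a primitive is [B(t) - 2 B(2t) - E(t)/2] with [B] and
    [E] the two primitives above. At 0 the poles [1/t] and the terms [ln t] cancel; the dilation by
    2 leaves [ln 2]. *)
Lemma fermi_integral (g0 g1 e0 e1 : R) :
  filterlim (fun x => bose_primitive x + (/ x + ln x / 2)) (at_right 0) (locally g0) ->
  filterlim bose_primitive (Rbar_locally p_infty) (locally g1) ->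
  filterlim (fun x => expint_primitive x - ln x) (at_right 0) (locally e0) ->
  filterlim expint_primitive (Rbar_locally p_infty) (locally e1) ->
  newton_integral (fun t => / (t * (exp t + 1)) - exp (- t) / t / 2)
    (g0 - g1 + (e0 - e1) / 2 - ln 2).
Proof.
intros G0 G1 E0 E1.
replace (g0 - g1 + (e0 - e1) / 2 - ln 2)
  with ((g1 - 2 * g1 - / 2 * e1) - (g0 - 2 * g0 - / 2 * e0 + ln 2)) by field.
apply newton_integral_intro with (fun t => bose_primitive t - 2 * bose_primitive (2 * t) - / 2 * expint_primitive t).
- intros t t0; generalize (expm1_pos t t0); intros H; evar_last.
  + apply (is_derive_minus (fun t => bose_primitive t - 2 * bose_primitive (2 * t)) (fun t => / 2 * expint_primitive t)).
    * apply (is_derive_minus bose_primitive (fun t => 2 * bose_primitive (2 * t))).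
      -- apply is_derive_bose_primitive; auto.
      -- apply (is_derive_scal (fun t => bose_primitive (2 * t))), is_derive_bose_primitive_dilation; lra.
    * apply (is_derive_scal expint_primitive), is_derive_expint; auto.
  + unfold minus, plus, opp; simpl; unfold calC_integrand_1_infty.
    replace (exp (2 * t)) with (exp t * exp t) by (rewrite <- exp_plus; f_equal; ring).
    field; repeat split; nra.
- apply (filterlim_ext_loc (fun t => (bose_primitive t + (/ t + ln t / 2))
    - 2 * (bose_primitive (2 * t) + (/ (2 * t) + ln (2 * t) / 2)) - / 2 * (expint_primitive t - ln t) + ln 2)).
  + generalize at_right_0_pos; apply filter_imp; intros t t0.
    rewrite ln_mult by lra; field; lra.
  + apply lim_plus; [|apply filterlim_const].
    apply lim_minus; [|apply lim_scal; auto].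
    apply lim_minus; auto; apply lim_scal.
    apply (lim_dilation_at_right_0 (fun x => bose_primitive x + (/ x + ln x / 2))); auto; lra.
- apply lim_minus; [|apply lim_scal; auto].
  apply lim_minus; auto; apply lim_scal.
  apply lim_dilation_p_infty; auto; lra.
Qed.

(** With [q = e^{-t}] the [i]-th summand is [q^{2i-1} (1-q)^2 / t], so the sum is geometric of ratio
    [q^2]. Written as a second difference, each summand is a difference of two Frullani integrands,
    with integral the logarithm of a Wallis factor. *)
Lemma sum_second_difference_exp (N : nat) (t : R) :
  0 < t ->
  exp (- t) * (1 - exp (- t)) * (1 - exp (- (2 * INR N * t))) / ((1 + exp (- t)) * t)
  = sum_n_m (fun i => (exp (- ((2 * INR i - 1) * t)) - exp (- (2 * INR i * t))) / t
      - (exp (- (2 * INR i * t)) - exp (- ((2 * INR i + 1) * t))) / t) 1 N.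
Proof.
intros t0; generalize (exp_pos (- t)); intros H; induction N as [|N IH].
- rewrite sum_n_m_zero by lia; simpl; rewrite Rmult_0_r, Rmult_0_l, Ropp_0, exp_0.
  unfold zero; simpl; field; lra.
- rewrite sum_n_m_Sr, <- IH, S_INR by lia.
  replace (- ((2 * (INR N + 1) - 1) * t)) with (- (2 * INR N * t) + - t) by ring.
  replace (- ((2 * (INR N + 1) + 1) * t)) with (- (2 * INR N * t) + (- t + (- t + - t))) by ring.
  replace (- (2 * (INR N + 1) * t)) with (- (2 * INR N * t) + (- t + - t)) by ring.
  rewrite !exp_plus; field; lra.
Qed.

(** The integrand equals [q(1-q) / (2t(1+q))]. Multiplying it by [1 - q^{2N}] gives half the finite
    sum above, whose integral is half the logarithm of a partial Wallis product; the error is at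
    most [1/(4N)]. *)
Lemma wallis_integral (v : R) :
  newton_integral (fun t => / (t * (exp t + 1)) - exp (- t) / t / 2) v ->
  v = / 2 * ln (PI / 2).
Proof.
intros Hv.
assert (W := is_lim_seq_scal_l _ (/ 2) _ wallis).
assert (L : is_lim_seq (fun N => / 2 * sum_n_m (fun i =>
    2 * ln (2 * INR i) - ln (2 * INR i - 1) - ln (2 * INR i + 1)) 1 N) v).
{ apply is_lim_seq_le_le_loc with (fun N => v - / 2 * (/ 2 * / INR N)) (fun _ => v).
  - exists 1%nat; intros N HN.
    assert (N0 : 0 < INR N) by (apply lt_0_INR; lia).
    assert (HS : newton_integral (fun t => / 2 * (exp (- t) * (1 - exp (- t))
        * (1 - exp (- (2 * INR N * t))) / ((1 + exp (- t)) * t)))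
      (/ 2 * sum_n_m (fun i =>
        2 * ln (2 * INR i) - ln (2 * INR i - 1) - ln (2 * INR i + 1)) 1 N)).
    { apply newton_integral_scal.
      eapply newton_integral_ext; [intros t t0; symmetry; apply sum_second_difference_exp; auto|].
      apply newton_integral_sum; intros k Hk.
      assert (1 <= INR k) by (change 1 with (INR 1); apply le_INR; lia).
      replace (2 * ln (2 * INR k) - ln (2 * INR k - 1) - ln (2 * INR k + 1)) with
        ((ln (2 * INR k) - ln (2 * INR k - 1)) - (ln (2 * INR k + 1) - ln (2 * INR k))) by ring.
      apply newton_integral_minus; apply frullani_exp; lra. }
    assert (rem : forall t, 0 < t ->
      / (t * (exp t + 1)) - exp (- t) / t / 2 = / 2 * (exp (- t) * (1 - exp (- t))
        * (1 - exp (- (2 * INR N * t))) / ((1 + exp (- t)) * t))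
        + / 2 * exp (- (2 * INR N * t)) * (exp (- t) / (1 + exp (- t)) * ((1 - exp (- t)) / t))).
    { intros t t0; generalize (exp_pos t); intros; rewrite (exp_Ropp t).
      field; repeat split; lra. }
    (* The remainder is [q^{2N}/2] times this factor, hence between 0 and [q^{2N}/2], of integral
       [1/(4N)]. *)
    assert (bnd : forall t, 0 < t ->
      0 <= exp (- t) / (1 + exp (- t)) * ((1 - exp (- t)) / t) <= 1).
    { intros t t0; generalize (exp_pos (- t)) (exp_ineq1_le (- t)); intros A B.
      assert (exp (- t) < 1) by (rewrite <- exp_0; apply exp_increasing; lra).
      assert (0 <= exp (- t) / (1 + exp (- t)) <= 1).
      { split; [apply Rle_div_r | apply Rle_div_l]; lra. }
      assert (0 <= (1 - exp (- t)) / t <= 1).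
      { split; [apply Rle_div_r | apply Rle_div_l]; lra. }
      nra. }
    split.
    + assert (HR : newton_integral (fun t => / 2 * exp (- (2 * INR N * t)))
        (/ 2 * (/ 2 * / INR N))).
      { rewrite <- Rinv_mult; apply newton_integral_scal, newton_integral_exp; lra. }
      assert (HT := newton_integral_plus _ _ _ _ HS HR).
      apply Rle_minus_l.
      refine (newton_integral_le _ _ _ _ _ Hv HT); intros t t0; simpl.
      rewrite rem by auto.
      generalize (bnd t t0) (exp_pos (- (2 * INR N * t))); intros; nra.
    + refine (newton_integral_le _ _ _ _ _ HS Hv); intros t t0; simpl.
      rewrite rem by auto.
      generalize (bnd t t0) (exp_pos (- (2 * INR N * t))); intros; nra.
  - replace (Finite v) with (Finite (v - / 2 * (/ 2 * 0))) by (f_equal; ring).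
    apply is_lim_seq_minus'; [apply is_lim_seq_const|].
    apply (is_lim_seq_scal_l _ (/ 2) (Finite (/ 2 * 0))).
    apply (is_lim_seq_scal_l _ (/ 2) (Finite 0)).
    apply (is_lim_seq_inv _ p_infty); [apply is_lim_seq_INR | discriminate].
  - apply is_lim_seq_const. }
apply is_lim_seq_unique in L; apply is_lim_seq_unique in W.
rewrite L in W; injection W; auto.
Qed.

Lemma calC_value : calC = / 2 * (ln (2 * PI) - euler_gamma).
Proof.
destruct bose_primitive_at_0 as [g0 G0]; destruct bose_primitive_at_infty as [g1 G1].
destruct expint_primitive_at_0 as [e0 E0]; destruct expint_primitive_at_infty as [e1 E1].
assert (V := wallis_integral _ (fermi_integral g0 g1 e0 e1 G0 G1 E0 E1)).
rewrite (calC_eq g0 g1 G0 G1), (euler_gamma_eq e0 e1 E0 E1).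
generalize PI_RGT_0; intros P.
rewrite ln_mult by lra; rewrite ln_div in V by lra; lra.
Qed.

(** * Popoviciu's formula *)

Lemma sin_rational_neq_0 (n p : nat) :
  (1 <= n)%nat -> ~ Nat.divide n p -> sin (INR p * PI / INR n) <> 0.
Proof.
intros Hn Hp Hs; apply Hp.
assert (n0 : 0 < INR n) by (apply lt_0_INR; lia).
destruct (sin_eq_0_0 _ Hs) as [k Hk]; generalize PI_RGT_0; intros P.
assert (E : INR p = IZR k * INR n).
{ apply (Rmult_eq_reg_r PI); [|lra].
  replace (INR p * PI) with (INR p * PI / INR n * INR n) by (field; lra).
  rewrite Hk; ring. }
rewrite !INR_IZR_INZ, <- mult_IZR in E; apply eq_IZR in E.
exists (Z.to_nat k); nia.
Qed.

Lemma sum_cos_telescope (x : R) (N : nat) :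
  sin ((2 * INR N + 1) * x) - sin x = 2 * sin x * sum_n_m (fun k => cos (INR k * (2 * x))) 1 N.
Proof.
induction N as [|N IH].
- rewrite sum_n_m_zero by lia; simpl; unfold zero; simpl.
  replace ((2 * 0 + 1) * x) with x by ring; ring.
- rewrite sum_n_m_Sr, Rmult_plus_distr_l, <- IH, S_INR by lia.
  replace ((2 * (INR N + 1) + 1) * x) with ((INR N + 1) * (2 * x) + x) by ring.
  replace ((2 * INR N + 1) * x) with ((INR N + 1) * (2 * x) - x) by ring.
  rewrite sin_plus, sin_minus; ring.
Qed.

(** The Dirichlet kernel at [x = p PI / n]: here [(2n-1) x = 2 p PI - x], so the left side of the
    telescoped identity is [-2 sin x], and [sin x] can be cancelled. *)
Lemma sum_cos_root_of_unity (n p : nat) :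
  (1 <= n)%nat -> ~ Nat.divide n p ->
  sum_n_m (fun k => cos (INR k * (2 * (INR p * PI / INR n)))) 1 (n - 1) = -1.
Proof.
intros Hn Hp; generalize (sin_rational_neq_0 n p Hn Hp)
  (sum_cos_telescope (INR p * PI / INR n) (n - 1)).
assert (n0 : 0 < INR n) by (apply lt_0_INR; lia).
intros Hs E; apply (Rmult_eq_reg_l (2 * sin (INR p * PI / INR n))); [|lra].
rewrite <- E, minus_INR by lia; simpl (INR 1).
replace ((2 * (INR n - 1) + 1) * (INR p * PI / INR n))
  with (- (INR p * PI / INR n) + 2 * INR p * PI) by (field; lra).
rewrite sin_period, sin_neg; ring.
Qed.

(** With [y = x + a], both [(sin (y+a) - sin (y-a)) cot a] and [cos (y+a) + cos (y-a)] equal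
    [2 cos y cos a]. *)
Lemma sin_cot_step (x a : R) :
  sin a <> 0 ->
  sin (x + 2 * a) * cot a = sin x * cot a + (cos (x + 2 * a) + cos x).
Proof.
intros Ha; replace (x + 2 * a) with ((x + a) + a) by ring.
replace x with ((x + a) - a) at 2 4 by ring; generalize (x + a); intros y.
rewrite sin_plus, sin_minus, cos_plus, cos_minus; unfold cot; field; auto.
Qed.

Lemma coprime_ndivide_mul (n m i : nat) :
  Nat.gcd m n = 1%nat -> (1 <= i < n)%nat -> ~ Nat.divide n (m * i).
Proof.
intros Hg Hi Hd; rewrite Nat.gcd_comm in Hg.
apply Nat.gauss in Hd; auto.
apply Nat.divide_pos_le in Hd; lia.
Qed.

(** Induction on [j]: a step adds two cosine sums, each equal to -1 by coprimality, so the value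
    drops by 2. *)
Lemma sum_sin_cot (n m j : nat) :
  Nat.gcd m n = 1%nat -> (1 <= j < n)%nat ->
  sum_n_m (fun k => sin (INR j * (2 * (INR m * INR k * PI / INR n)))
    * cot (INR m * INR k * PI / INR n)) 1 (n - 1) = INR n - 2 * INR j.
Proof.
intros Hg Hj.
assert (n0 : 0 < INR n) by (apply lt_0_INR; lia).
assert (Hc : forall i, (1 <= i < n)%nat ->
  sum_n_m (fun k => cos (INR i * (2 * (INR m * INR k * PI / INR n)))) 1 (n - 1) = -1).
{ intros i Hi.
  rewrite <- (sum_cos_root_of_unity n (m * i)); [|lia|apply coprime_ndivide_mul; auto].
  apply sum_n_m_ext; intros k; rewrite mult_INR; f_equal; field; lra. }
assert (step : forall i,
  sum_n_m (fun k => sin (INR (S i) * (2 * (INR m * INR k * PI / INR n)))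
    * cot (INR m * INR k * PI / INR n)) 1 (n - 1) =
  sum_n_m (fun k => sin (INR i * (2 * (INR m * INR k * PI / INR n)))
    * cot (INR m * INR k * PI / INR n)) 1 (n - 1) +
  (sum_n_m (fun k => cos (INR (S i) * (2 * (INR m * INR k * PI / INR n)))) 1 (n - 1)
   + sum_n_m (fun k => cos (INR i * (2 * (INR m * INR k * PI / INR n)))) 1 (n - 1))).
{ intros i; rewrite <- !sum_n_m_Rplus.
  apply sum_n_m_ext_loc; intros k Hk; rewrite S_INR.
  replace ((INR i + 1) * (2 * (INR m * INR k * PI / INR n))) with
    (INR i * (2 * (INR m * INR k * PI / INR n)) + 2 * (INR m * INR k * PI / INR n)) by ring.
  apply sin_cot_step.
  rewrite <- mult_INR; apply sin_rational_neq_0; [|apply coprime_ndivide_mul]; auto; lia. }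
assert (H0 : sum_n_m (fun k => sin (INR 0 * (2 * (INR m * INR k * PI / INR n)))
    * cot (INR m * INR k * PI / INR n)) 1 (n - 1) = 0).
{ rewrite (sum_n_m_ext _ (fun _ => 0)).
  - rewrite sum_n_m_const; eq_in_R; ring.
  - intros k; simpl; rewrite Rmult_0_l, sin_0; eq_in_R; ring. }
(* At index 0 the cosine sum is [n - 1] instead of -1. The first step therefore goes from 0 to
   [n - 2]: this is the jump of the sawtooth. *)
assert (C0 : sum_n_m (fun k => cos (INR 0 * (2 * (INR m * INR k * PI / INR n)))) 1 (n - 1)
  = INR n - 1).
{ rewrite (sum_n_m_ext _ (fun _ => 1)).
  - rewrite sum_n_m_const; replace (S (n - 1) - 1)%nat with (n - 1)%nat by lia.
    rewrite minus_INR by lia; simpl; eq_in_R; ring.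
  - intros k; simpl; rewrite Rmult_0_l, cos_0; eq_in_R; ring. }
destruct j as [|j]; [lia|]; induction j as [|j IH].
- rewrite step, H0, C0, Hc by lia; simpl; eq_in_R; ring.
- rewrite step, IH, !Hc by lia; rewrite !S_INR; eq_in_R; ring.
Qed.

(* Eisenstein's expansion of the sawtooth: if [n] divides [m * j + N] then this is
   [{j/n} - 1/2], or [0] when [n] divides [N]. *)
Definition saw (n m N : nat) : R :=
  / (2 * INR n) * sum_n_m (fun k => cot (INR m * INR k * PI / INR n)
    * sin (INR N * (2 * (INR k * PI / INR n)))) 1 (n - 1).

Definition dvd_ind (n N : nat) : R := if Nat.eqb (N mod n) 0 then 1 else 0.

(** Since [N] is congruent to [-m j] modulo [n], periodicity turns [saw] into [-1/(2n)] times the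
    sum of [sum_sin_cot], that is [j/n - 1/2] for [j >= 1]. For [j = 0] that sum is 0 and the
    indicator term supplies the missing [-1/2]. *)
Lemma saw_spec (n m N j : nat) :
  (1 <= n)%nat -> Nat.gcd m n = 1%nat -> (j < n)%nat -> Nat.divide n (m * j + N) ->
  saw n m N - / 2 * dvd_ind n N + / 2 = INR j / INR n.
Proof.
intros Hn Hg Hj [q Hq].
assert (n0 : 0 < INR n) by (apply lt_0_INR; lia).
assert (Es : saw n m N = - / (2 * INR n) *
  sum_n_m (fun k => sin (INR j * (2 * (INR m * INR k * PI / INR n)))
    * cot (INR m * INR k * PI / INR n)) 1 (n - 1)).
{ unfold saw.
  replace (- / (2 * INR n)) with (/ (2 * INR n) * -1) by ring.
  rewrite Rmult_assoc; f_equal; rewrite <- sum_n_m_Rmult_l; apply sum_n_m_ext; intros k.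
  assert (EN : INR N = INR q * INR n - INR m * INR j).
  { apply (f_equal INR) in Hq; rewrite plus_INR, !mult_INR in Hq; lra. }
  replace (INR N * (2 * (INR k * PI / INR n))) with
    (- (INR j * (2 * (INR m * INR k * PI / INR n))) + 2 * INR (q * k) * PI)
    by (rewrite mult_INR, EN; field; lra).
  rewrite sin_period, sin_neg; eq_in_R; ring. }
rewrite Es; destruct j as [|j].
- rewrite (sum_n_m_ext _ (fun _ => 0)), sum_n_m_const;
    [|intros k; simpl; rewrite Rmult_0_l, sin_0; eq_in_R; ring].
  unfold dvd_ind; replace (N mod n)%nat with 0%nat; [simpl; field; lra|].
  symmetry; apply Nat.Lcm0.mod_divide; exists q; lia.
- rewrite sum_sin_cot by (auto; lia).
  unfold dvd_ind; destruct (Nat.eqb_spec (N mod n) 0) as [H|H]; [|field; lra].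
  exfalso; apply (coprime_ndivide_mul n m (S j)); auto; [lia|].
  apply Nat.Lcm0.mod_divide in H.
  replace (m * S j)%nat with (m * S j + N - N)%nat by lia.
  apply Nat.divide_sub_r; auto; exists q; lia.
Qed.

Lemma ex_residue (n m N : nat) :
  (1 <= m)%nat -> (1 <= n)%nat -> Nat.gcd m n = 1%nat ->
  exists j, (j < n)%nat /\ Nat.divide n (m * j + N).
Proof.
intros Hm Hn Hg; destruct (Nat.gcd_bezout_pos m n) as (u & v & Huv); [lia|].
rewrite Hg in Huv.
(* By Bezout [u] inverts [m] modulo [n], and [n - 1] stands for -1 within the natural numbers. *)
exists ((u * N * (n - 1)) mod n)%nat; split; [apply Nat.mod_upper_bound; lia|].
set (x := (u * N * (n - 1))%nat).
assert (Hx := Nat.div_mod_eq x n).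
apply (Nat.divide_add_cancel_r n (m * (n * (x / n)))).
- exists (m * (x / n))%nat; ring.
- replace (m * (n * (x / n)) + (m * (x mod n) + N))%nat with (m * x + N)%nat by nia.
  exists (N + v * N * (n - 1))%nat; unfold x.
  replace (m * (u * N * (n - 1)) + N)%nat with (u * m * (N * (n - 1)) + N)%nat by ring.
  rewrite Huv; destruct n; [lia|]; replace (S n - 1)%nat with n by lia; ring.
Qed.

(* For [N >= 1] the number of pairs [i, j >= 1] with [m * i + n * j = N];
   at [N = 0] the formula gives [-1]. *)
Definition popoviciu (m n N : nat) : R :=
  INR N / (INR m * INR n) - / 2 * dvd_ind n N - / 2 * dvd_ind m N + saw n m N + saw m n N.

Lemma popoviciu_spec (m n N j l : nat) :
  (1 <= m)%nat -> (1 <= n)%nat -> Nat.gcd m n = 1%nat ->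
  (j < n)%nat -> Nat.divide n (m * j + N) ->
  (l < m)%nat -> Nat.divide m (n * l + N) ->
  popoviciu m n N = INR N / (INR m * INR n) - 1 + INR j / INR n + INR l / INR m.
Proof.
intros Hm Hn Hg Hj Dj Hl Dl.
rewrite <- (saw_spec n m N j), <- (saw_spec m n N l); auto; [unfold popoviciu; field|].
- split; apply not_0_INR; lia.
- rewrite Nat.gcd_comm; auto.
Qed.

(** [m j + n l + N] is divisible by [m] and by [n], hence by [m n]. For [0 < N < m + n] it lies
    strictly between 0 and [2 m n], so it equals [m n] and the formula gives 0. At [N = 0] both
    residues are 0 and -1 remains. *)
Lemma popoviciu_vanish (m n N : nat) :
  (1 <= m)%nat -> (1 <= n)%nat -> Nat.gcd m n = 1%nat ->
  (N < m + n)%nat -> popoviciu m n N = if Nat.eqb N 0 then -1 else 0.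
Proof.
intros Hm Hn Hg HN; assert (Hg' : Nat.gcd n m = 1%nat) by (rewrite Nat.gcd_comm; auto).
assert (m0 : 0 < INR m) by (apply lt_0_INR; lia).
assert (n0 : 0 < INR n) by (apply lt_0_INR; lia).
destruct (Nat.eqb_spec N 0) as [->|N0].
- rewrite (popoviciu_spec m n 0 0 0); auto; try lia; try (exists 0%nat; lia).
  simpl; field; lra.
- destruct (ex_residue n m N) as (j & Hj & Dj); auto.
  destruct (ex_residue m n N) as (l & Hl & Dl); auto.
  rewrite (popoviciu_spec m n N j l); auto.
  assert (D : Nat.divide (m * n) (m * j + n * l + N)).
  { assert (Dn : Nat.divide n (m * j + n * l + N)).
    { replace (m * j + n * l + N)%nat with (n * l + (m * j + N))%nat by lia.
      apply Nat.divide_add_r; auto; exists l; lia. }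
    assert (Dm : Nat.divide m (m * j + n * l + N)).
    { replace (m * j + n * l + N)%nat with (m * j + (n * l + N))%nat by lia.
      apply Nat.divide_add_r; auto; exists j; lia. }
    destruct Dn as [c Hc]; rewrite Hc, Nat.mul_comm in Dm.
    apply Nat.gauss in Dm; auto; destruct Dm as [d ->].
    exists d; rewrite Hc; ring. }
  destruct D as [q Hq].
  assert (m * j <= m * (n - 1))%nat by (apply Nat.mul_le_mono_l; lia).
  assert (n * l <= n * (m - 1))%nat by (apply Nat.mul_le_mono_l; lia).
  assert (m * (n - 1) + m = m * n /\ n * (m - 1) + n = m * n)%nat
    by (split; [destruct n | destruct m]; nia).
  assert (0 < q * (m * n) < 2 * (m * n))%nat by lia.
  (* The value is the integer [q - 1], and the bounds force [q = 1]. *)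
  assert (q = 1)%nat by nia; subst q.
  apply (f_equal INR) in Hq; rewrite !plus_INR, !mult_INR in Hq; simpl (INR 1) in Hq.
  apply (Rmult_eq_reg_r (INR m * INR n)); [field_simplify; lra | nra].
Qed.

(** The formula is a linear term plus a function of [N] modulo [n] plus a function of [N] modulo
    [m]. Each of the three is killed by the product of the difference operators of steps [m] and
    [n]. *)
Lemma popoviciu_rec (m n N : nat) :
  (1 <= m)%nat -> (1 <= n)%nat -> Nat.gcd m n = 1%nat ->
  popoviciu m n (m + n + N) = popoviciu m n (n + N) + popoviciu m n (m + N) - popoviciu m n N.
Proof.
intros Hm Hn Hg; assert (Hg' : Nat.gcd n m = 1%nat) by (rewrite Nat.gcd_comm; auto).
destruct (ex_residue n m N) as (j1 & Hj1 & Dj1); auto.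
destruct (ex_residue n m (m + N)) as (j2 & Hj2 & Dj2); auto.
destruct (ex_residue m n N) as (l1 & Hl1 & Dl1); auto.
destruct (ex_residue m n (n + N)) as (l2 & Hl2 & Dl2); auto.
assert (shift : forall d x y, Nat.divide d (x + y) -> Nat.divide d (x + (d + y))).
{ intros d x y [q Hq]; exists (S q); lia. }
rewrite (popoviciu_spec m n N j1 l1), (popoviciu_spec m n (m + N) j2 l1), (popoviciu_spec m n (n + N) j1 l2),
  (popoviciu_spec m n (m + n + N) j2 l2); auto.
- rewrite !plus_INR; field; split; apply not_0_INR; lia.
- replace (m + n + N)%nat with (n + (m + N))%nat by lia; auto.
- replace (m + n + N)%nat with (m + (n + N))%nat by lia; auto.
Qed.

(** * Generating functions and partial fractions *)

Lemma is_series_Rplus (u v : nat -> R) (a b : R) :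
  is_series u a -> is_series v b -> is_series (fun N => u N + v N) (a + b).
Proof. exact (is_series_plus u v a b). Qed.

Lemma is_series_Rscal (c : R) (u : nat -> R) (a : R) :
  is_series u a -> is_series (fun N => c * u N) (c * a).
Proof. exact (is_series_scal c u a). Qed.

Lemma is_series_eq (u v : nat -> R) (a b : R) :
  is_series u a -> is_series v b -> (forall N, v N = u N) -> a = b.
Proof.
intros A B uv; apply (is_series_ext _ _ _ uv) in B.
rewrite <- (is_series_unique _ _ A); apply is_series_unique; auto.
Qed.

Section GeneratingFunctions.
Variables (w : R) (w0 : 0 < w) (w1 : w < 1).

Lemma is_series_shift (u : nat -> R) (p : nat) (v : R) :
  (1 <= p)%nat -> is_series (fun N => u N * w ^ N) v ->
  is_series (fun N => u (p + N)%nat * w ^ (p + N)) (v - sum_n (fun N => u N * w ^ N) (p - 1)).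
Proof.
intros Hp Hv; apply (is_series_incr_n (fun N => u N * w ^ N)); [lia|].
replace (Init.Nat.pred p) with (p - 1)%nat by lia.
set (S := sum_n _ _).
match goal with |- is_series _ ?x => assert (Ex : x = v) end.
{ change (v - S + S = v); ring. }
rewrite Ex; exact Hv.
Qed.

Lemma ex_series_bounded (u : nat -> R) :
  (forall N, Rabs (u N) <= 1) -> exists v, is_series (fun N => u N * w ^ N) v.
Proof.
intros Hu; apply (ex_series_le (K := R_AbsRing) (V := R_CompleteNormedModule) _ (fun N => w ^ N)).
- intros N; change (Rabs (u N * w ^ N) <= w ^ N).
  rewrite Rabs_mult, (Rabs_pos_eq (w ^ N)) by (apply pow_le; lra).
  specialize (Hu N); generalize (pow_le w N (Rlt_le _ _ w0)); nra.
- exists (/ (1 - w)); apply is_series_geom; rewrite Rabs_pos_eq; lra.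
Qed.

Lemma quadratic_pos (c : R) : -1 <= c <= 1 -> 0 < 1 - 2 * w * c + w ^ 2.
Proof. intros; nra. Qed.

(** Convergence comes first; then the recurrence [sin((N+2)x) = 2 cos x sin((N+1)x) - sin(Nx)]
    becomes a linear equation for the sum. The other generating functions obtained from recurrences
    follow the same pattern. *)
Lemma gf_sin (x : R) :
  is_series (fun N => sin (INR N * x) * w ^ N) (w * sin x / (1 - 2 * w * cos x + w ^ 2)).
Proof.
destruct (ex_series_bounded (fun N => sin (INR N * x))) as [v Hv].
{ intros N; apply Rabs_le, SIN_bound. }
generalize (quadratic_pos (cos x) (COS_bound x)); intros D.
replace (w * sin x / (1 - 2 * w * cos x + w ^ 2)) with v; auto.
assert (H1 := is_series_shift _ 1 _ (le_n 1) Hv).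
assert (H2 := is_series_shift _ 2 _ (le_S _ _ (le_n 1)) Hv).
assert (H2' := is_series_Rplus _ _ _ _ (is_series_Rscal (2 * cos x * w) _ _ H1)
  (is_series_Rscal (- w ^ 2) _ _ Hv)).
assert (E := is_series_eq _ _ _ _ H2 H2').
lapply E; clear E; [intros E|].
2: { intros N; simpl (1 + N)%nat; simpl (2 + N)%nat; rewrite !S_INR.
  replace ((INR N + 1 + 1) * x) with ((INR N + 1) * x + x) by ring.
  replace (INR N * x) with ((INR N + 1) * x - x) by ring.
  rewrite sin_plus, sin_minus; simpl; eq_in_R; ring. }
change (2 - 1)%nat with 1%nat in E; change (1 - 1)%nat with 0%nat in E.
rewrite sum_Sn, !sum_O in E.
unfold plus in E; simpl in E.
rewrite Rmult_0_l, sin_0, Rmult_1_l in E.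
apply (Rmult_eq_reg_r (1 - 2 * w * cos x + w ^ 2)); [|lra].
field_simplify; [|lra]; lra.
Qed.

Lemma gf_dvd_ind (n : nat) :
  (1 <= n)%nat -> is_series (fun N => dvd_ind n N * w ^ N) (/ (1 - w ^ n)).
Proof.
intros Hn; destruct (ex_series_bounded (dvd_ind n)) as [v Hv].
{ intros N; unfold dvd_ind; destruct Nat.eqb; rewrite Rabs_pos_eq; lra. }
assert (H1 := is_series_shift _ n _ Hn Hv).
assert (E := is_series_eq _ _ _ _ H1 (is_series_Rscal (w ^ n) _ _ Hv)).
lapply E; clear E; [intros E|].
2: { intros N; unfold dvd_ind; rewrite pow_add.
  replace ((n + N) mod n)%nat with (N mod n)%nat; [eq_in_R; ring|].
  replace (n + N)%nat with (N + 1 * n)%nat by lia; rewrite Nat.Div0.mod_add; auto. }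
(* One period [0, ..., n-1] contains a single multiple of [n], namely 0. *)
assert (S1 : sum_n (fun N => dvd_ind n N * w ^ N) (n - 1) = 1).
{ assert (K : forall p, (p < n)%nat -> sum_n (fun N => dvd_ind n N * w ^ N) p = 1);
    [|apply K; lia].
  induction p as [|p IH]; intros Hp.
  - rewrite sum_O; unfold dvd_ind; rewrite Nat.Div0.mod_0_l; simpl; eq_in_R; ring.
  - rewrite sum_Sn, IH by lia; unfold dvd_ind; rewrite Nat.mod_small by lia.
    unfold plus; simpl; eq_in_R; ring. }
rewrite S1 in E.
assert (w ^ n < 1) by (apply pow_lt_1_compat; [lra|lia]).
replace (/ (1 - w ^ n)) with v; auto.
apply (Rmult_eq_reg_r (1 - w ^ n)); [|lra]; rewrite Rinv_l; lra.
Qed.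

Lemma gf_id : is_series (fun N => INR N * w ^ N) (w / (1 - w) ^ 2).
Proof.
assert (HG : is_series (fun N => w ^ N) (/ (1 - w)))
  by (apply is_series_geom; rewrite Rabs_pos_eq; lra).
assert (Hex : exists v, is_series (fun N => INR N * w ^ N) v).
(* The ratio test requires nonzero terms, and [N w^N] vanishes at [N = 0]; hence the detour through
   [(N+1) w^N]. *)
{ assert (Hex : ex_series (fun N => INR (S N) * w ^ N)).
  { apply ex_series_Rabs, (ex_series_DAlembert _ w); auto.
    - intros N; apply Rmult_integral_contrapositive; split;
        [apply not_0_INR; lia | apply pow_nonzero; lra].
    - apply is_lim_seq_ext with (fun N => w + w * / INR (N + 1)).
      + intros N; assert (0 < INR (S N)) by (apply lt_0_INR; lia).
        assert (0 < w ^ N) by (apply pow_lt; auto).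
        rewrite (S_INR (S N)), Nat.add_1_r; simpl (w ^ S N).
        rewrite Rabs_pos_eq; [field; lra|].
        apply Rle_div_r; [nra|]; rewrite Rmult_0_l; apply Rmult_le_pos; [lra|nra].
      + replace (Finite w) with (Finite (w + w * 0)) by (f_equal; ring).
        apply is_lim_seq_plus'; [apply is_lim_seq_const|].
        apply (is_lim_seq_scal_l _ w (Finite 0)).
        apply (is_lim_seq_incr_n (fun n => / INR n) 1).
        apply (is_lim_seq_inv _ p_infty); [apply is_lim_seq_INR | discriminate]. }
  destruct Hex as [v Hv]; exists (v + -1 * / (1 - w)).
  apply (is_series_ext (fun N => INR (S N) * w ^ N + -1 * w ^ N)).
  - intros N; rewrite S_INR; eq_in_R; ring.
  - apply is_series_Rplus; auto; apply is_series_Rscal; auto. }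
destruct Hex as [v Hv].
assert (H1 := is_series_shift _ 1 _ (le_n 1) Hv).
assert (H2 := is_series_Rplus _ _ _ _ (is_series_Rscal w _ _ Hv) (is_series_Rscal w _ _ HG)).
assert (E := is_series_eq _ _ _ _ H1 H2).
lapply E; clear E; [intros E|].
2: { intros N; simpl (1 + N)%nat; rewrite S_INR; simpl; eq_in_R; ring. }
rewrite sum_O in E; simpl in E.
replace (w / (1 - w) ^ 2) with v; auto.
apply (Rmult_eq_reg_r (1 - w)); [|lra].
replace (w / (1 - w) ^ 2 * (1 - w)) with (w * / (1 - w)) by (field; lra); lra.
Qed.

Lemma is_series_sum (f : nat -> nat -> R) (l : nat -> R) (a b : nat) :
  (forall k, is_series (f k) (l k)) ->
  is_series (fun N => sum_n_m (fun k => f k N) a b) (sum_n_m l a b).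
Proof.
intros Hf; assert (Z : is_series (fun _ : nat => 0) 0).
{ assert (H : Rabs 0 < 1) by (rewrite Rabs_R0; lra).
  apply is_series_geom, (is_series_Rscal 0) in H; rewrite Rmult_0_l in H.
  revert H; apply is_series_ext; intros; eq_in_R; ring. }
induction b as [|b IH].
- destruct a as [|a].
  + rewrite sum_n_n; apply (is_series_ext (f 0%nat)); auto.
    intros; rewrite sum_n_n; auto.
  + rewrite sum_n_m_zero by lia.
    apply (is_series_ext (fun _ => 0)); auto; intros; rewrite sum_n_m_zero by lia; auto.
- destruct (Nat.le_gt_cases a (S b)) as [ab|ab].
  + rewrite sum_n_m_Sr by lia.
    apply (is_series_ext (fun N => sum_n_m (fun k => f k N) a b + f (S b) N)).
    { intros; rewrite sum_n_m_Sr by lia; auto. }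
    apply is_series_Rplus; auto.
  + rewrite sum_n_m_zero by lia.
    apply (is_series_ext (fun _ => 0)); auto; intros; rewrite sum_n_m_zero by lia; auto.
Qed.

Lemma gf_saw (n m : nat) :
  is_series (fun N => saw n m N * w ^ N)
    (/ (2 * INR n) * sum_n_m (fun k => cot (INR m * INR k * PI / INR n) *
      (w * sin (2 * (INR k * PI / INR n))
        / (1 - 2 * w * cos (2 * (INR k * PI / INR n)) + w ^ 2))) 1 (n - 1)).
Proof.
apply (is_series_ext (fun N => / (2 * INR n) * sum_n_m (fun k =>
  cot (INR m * INR k * PI / INR n) * (sin (INR N * (2 * (INR k * PI / INR n))) * w ^ N))
  1 (n - 1))).
{ intros N; unfold saw; eq_in_R; rewrite Rmult_assoc; f_equal.
  rewrite Rmult_comm, <- sum_n_m_Rmult_l; apply sum_n_m_ext; intros; eq_in_R; ring. }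
apply is_series_Rscal, is_series_sum; intros k; apply is_series_Rscal, gf_sin.
Qed.

(** The recurrence gives [v + 1 = (w^m + w^n)(v + 1) - w^{m+n} v] for the sum [v], since every
    initial segment of at most [m + n] terms sums to -1. The final -1 is the exceptional coefficient
    at [N = 0]. *)
Lemma gf_popoviciu (m n : nat) :
  (1 <= m)%nat -> (1 <= n)%nat -> Nat.gcd m n = 1%nat ->
  is_series (fun N => popoviciu m n N * w ^ N)
    (w ^ (m + n) / ((1 - w ^ m) * (1 - w ^ n)) - 1).
Proof.
intros Hm Hn Hg.
assert (Hex : exists v, is_series (fun N => popoviciu m n N * w ^ N) v).
{ eexists; eapply is_series_ext; [intros N|].
  2: { apply is_series_Rplus; [apply is_series_Rplus; [apply is_series_Rplus;
    [apply is_series_Rplus|]|]|].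
    - apply (is_series_Rscal (/ (INR m * INR n))), gf_id.
    - apply (is_series_Rscal (- / 2)), (gf_dvd_ind n); auto.
    - apply (is_series_Rscal (- / 2)), (gf_dvd_ind m); auto.
    - apply (gf_saw n m).
    - apply (gf_saw m n). }
  unfold popoviciu, Rdiv; eq_in_R; ring. }
destruct Hex as [v Hv].
assert (S1 : forall p, (1 <= p)%nat -> (p <= m + n)%nat ->
  sum_n (fun N => popoviciu m n N * w ^ N) (p - 1) = -1).
{ intros p Hp1 Hp2.
  assert (K : forall p, (p < m + n)%nat -> sum_n (fun N => popoviciu m n N * w ^ N) p = -1);
    [|apply K; lia].
  induction p0 as [|p0 IH]; intros Hp0.
  - rewrite sum_O, popoviciu_vanish; auto; try lia; simpl; eq_in_R; ring.
  - rewrite sum_Sn, IH, popoviciu_vanish; auto; try lia.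
    unfold plus; simpl; eq_in_R; ring. }
assert (Hmn : (1 <= m + n)%nat) by lia.
assert (H1 := is_series_shift _ _ _ Hmn Hv).
assert (H2 := is_series_Rplus _ _ _ _ (is_series_Rplus _ _ _ _
  (is_series_Rscal (w ^ m) _ _ (is_series_shift _ _ _ Hn Hv))
  (is_series_Rscal (w ^ n) _ _ (is_series_shift _ _ _ Hm Hv)))
  (is_series_Rscal (- w ^ (m + n)) _ _ Hv)).
assert (E := is_series_eq _ _ _ _ H1 H2).
lapply E; clear E; [intros E|].
2: { intros N; rewrite popoviciu_rec by auto; rewrite !pow_add; eq_in_R; ring. }
rewrite !S1 in E by lia.
assert (w ^ n < 1) by (apply pow_lt_1_compat; [lra|lia]).
assert (w ^ m < 1) by (apply pow_lt_1_compat; [lra|lia]).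
rewrite pow_add in *.
replace (w ^ m * w ^ n / ((1 - w ^ m) * (1 - w ^ n)) - 1) with v; auto.
apply (Rmult_eq_reg_r ((1 - w ^ m) * (1 - w ^ n))); [|nra].
field_simplify; [|lra]; lra.
Qed.

(** Two evaluations of the same series: by its recurrence, and term by term from the definition of
    [popoviciu]. *)
Lemma partial_fractions (m n : nat) :
  (1 <= m)%nat -> (1 <= n)%nat -> Nat.gcd m n = 1%nat ->
  w ^ (m + n) / ((1 - w ^ m) * (1 - w ^ n)) =
    w / (1 - w) ^ 2 / (INR m * INR n)
    - / 2 * (w ^ n / (1 - w ^ n)) - / 2 * (w ^ m / (1 - w ^ m))
    + / (2 * INR n) * sum_n_m (fun k => cot (INR m * INR k * PI / INR n) *
        (w * sin (2 * (INR k * PI / INR n))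
          / (1 - 2 * w * cos (2 * (INR k * PI / INR n)) + w ^ 2))) 1 (n - 1)
    + / (2 * INR m) * sum_n_m (fun k => cot (INR n * INR k * PI / INR m) *
        (w * sin (2 * (INR k * PI / INR m))
          / (1 - 2 * w * cos (2 * (INR k * PI / INR m)) + w ^ 2))) 1 (m - 1).
Proof.
intros Hm Hn Hg; assert (H := gf_popoviciu m n Hm Hn Hg).
assert (H' := is_series_Rplus _ _ _ _ (is_series_Rplus _ _ _ _ (is_series_Rplus _ _ _ _
  (is_series_Rplus _ _ _ _ (is_series_Rscal (/ (INR m * INR n)) _ _ gf_id)
  (is_series_Rscal (- / 2) _ _ (gf_dvd_ind n Hn)))
  (is_series_Rscal (- / 2) _ _ (gf_dvd_ind m Hm))) (gf_saw n m)) (gf_saw m n)).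
assert (E := is_series_eq _ _ _ _ H H').
lapply E; clear E; [intros E|].
2: { intros N; unfold popoviciu, Rdiv; eq_in_R; ring. }
assert (w ^ n < 1) by (apply pow_lt_1_compat; [lra|lia]).
assert (w ^ m < 1) by (apply pow_lt_1_compat; [lra|lia]).
(* The two halves released by these rewritings absorb the -1 of [gf_popoviciu]. *)
replace (w ^ n / (1 - w ^ n)) with (/ (1 - w ^ n) - 1) by (field; lra).
replace (w ^ m / (1 - w ^ m)) with (/ (1 - w ^ m) - 1) by (field; lra).
lra.
Qed.

End GeneratingFunctions.

(** * The autocorrelation integral *)

Lemma newton_integral_is_RInt_gen (f : R -> R) (l : R) :
  (forall t, 0 < t -> continuous f t) -> newton_integral f l ->
  is_RInt_gen f (at_right 0) (Rbar_locally p_infty) l.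
Proof.
intros cf (F & a & b & dF & Fa & Fb & ->).
apply (improper_integral_of_antiderivative (at_right 0) (Rbar_locally p_infty) _ _ F);
  auto; [exact at_right_0_pos | exact p_infty_pos].
Qed.

(** The quotient [(1 - e^{-t})/(1 + e^{-t})] is [tanh(t/2)], and [atan (cot p * tanh(t/2))] is a
    primitive. It runs from 0 to [atan (cot p) = PI/2 - p], as [PI/2 - p] lies in the principal
    range. *)
Lemma root_of_unity_integral (p : R) :
  0 < p < PI ->
  newton_integral (fun t => exp (- t) * sin (2 * p)
    / (1 - 2 * exp (- t) * cos (2 * p) + exp (- t) ^ 2)) (PI / 2 - p).
Proof.
intros Hp; assert (Sp : 0 < sin p) by (apply sin_gt_0; lra).
assert (Ap : atan (cot p) = PI / 2 - p).
{ rewrite <- (atan_tan (PI / 2 - p)) by lra; f_equal; unfold cot, tan.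
  rewrite sin_shift, cos_shift; reflexivity. }
assert (V1 : atan (cot p * ((1 - 0) / (1 + 0))) = PI / 2 - p)
  by (rewrite <- Ap; f_equal; field).
assert (V0 : atan (cot p * ((1 - exp (- 0)) / (1 + exp (- 0)))) = 0)
  by (rewrite Ropp_0, exp_0, Rminus_diag, Rdiv_0_l, Rmult_0_r; apply atan_0).
replace (PI / 2 - p) with (atan (cot p * ((1 - 0) / (1 + 0)))
  - atan (cot p * ((1 - exp (- 0)) / (1 + exp (- 0))))) by (rewrite V1, V0; ring).
apply newton_integral_intro with
  (fun t => atan (cot p * ((1 - exp (- t)) / (1 + exp (- t))))).
- intros t t0; generalize (exp_pos (- t)); intros Hw.
  evar_last.
  + apply (is_derive_comp atan (fun t => cot p * ((1 - exp (- t)) / (1 + exp (- t))))).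
    * apply is_derive_Reals, derivable_pt_lim_atan.
    * auto_derive; [lra | reflexivity].
  + unfold scal; simpl; unfold mult; simpl; unfold cot.
    rewrite sin_2a, cos_2a_sin; generalize (sin2_cos2 p); unfold Rsqr; intros E.
    (* Rewritten as [(1+q)^2 sin^2 p + (1-q)^2 cos^2 p], the denominator is visibly positive and
       matches the one produced by the derivative of [atan]. *)
    replace (1 - 2 * exp (- t) * (1 - 2 * sin p * sin p)
        + exp (- t) * (exp (- t) * 1)) with
      ((1 + exp (- t)) ^ 2 * (sin p * sin p)
        + (1 - exp (- t)) ^ 2 * (1 - sin p * sin p)) by ring.
    replace (1 - sin p * sin p) with (cos p * cos p) by lra.
    assert (0 < (1 + exp (- t)) ^ 2 * (sin p * sin p)) by (apply Rmult_lt_0_compat; nra).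
    assert (0 <= (1 - exp (- t)) ^ 2 * (cos p * cos p)) by (apply Rmult_le_pos; [apply pow2_ge_0 | apply Rle_0_sqr]).
    field; repeat split; nra.
- apply (continuous_lim_at_right_0
    (fun t => atan (cot p * ((1 - exp (- t)) / (1 + exp (- t)))))); auto.
  apply (continuous_comp (fun t => cot p * ((1 - exp (- t)) / (1 + exp (- t)))) atan).
  + apply (ex_derive_continuous (fun t => cot p * ((1 - exp (- t)) / (1 + exp (- t))))).
    generalize (exp_pos (- 0)); intros; auto_derive; lra.
  + apply continuity_pt_filterlim, derivable_continuous_pt, derivable_pt_atan.
- apply (lim_continuous (fun w => atan (cot p * ((1 - w) / (1 + w))))); [|exact exp_opp_p_infty].
  apply (continuous_comp (fun w => cot p * ((1 - w) / (1 + w))) atan).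
  + apply (ex_derive_continuous (fun w => cot p * ((1 - w) / (1 + w)))); auto_derive; lra.
  + apply continuity_pt_filterlim, derivable_continuous_pt, derivable_pt_atan.
Qed.

Lemma bose_at_0 :
  filterlim (fun t => / t - / (exp t - 1)) (at_right 0) (locally (/ 2)).
Proof.
assert (L : filterlim (fun t => / (exp t - 1) - / t + / 2) (at_right 0) (locally 0)).
{ apply lim_squeeze_0 with (fun t => / 2 * t); [typeclasses eauto| |].
  - generalize at_right_0_pos; apply filter_imp; intros t t0.
    generalize (bose_bounds t t0); intros; rewrite Rabs_pos_eq; lra.
  - generalize (lim_scal (/ 2) _ _ id_at_right_0); rewrite Rmult_0_r; auto. }
apply (lim_minus _ _ _ _ (filterlim_const (/ 2))) in L; rewrite Rminus_0_r in L.
revert L; apply filterlim_ext; intros t; ring.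
Qed.

Lemma bose_at_infty :
  filterlim (fun t => / (exp t - 1)) (Rbar_locally p_infty) (locally 0).
Proof.
apply lim_squeeze_0 with Rinv; [typeclasses eauto| |exact inv_p_infty].
generalize p_infty_pos; apply filter_imp; intros t t0.
generalize (expm1_pos t t0); intros H; rewrite Rabs_pos_eq.
- apply Rinv_le_contravar; lra.
- apply Rlt_le, Rinv_0_lt_compat; lra.
Qed.

(** Everything except the cotangent terms; the summands diverge separately at 0 and are integrated
    together. There the poles combine into [1/t - 1/(e^t - 1)], of limit [1/2], the terms [ln t]
    cancel, and the logarithms of the dilations leave [(n-m)/2 (ln n - ln m)]. *)
Lemma singular_part_integral (m n : R) :
  0 < m -> 0 < n ->
  newton_integral (fun t => / t ^ 2 - n * / (t * (exp (n * t) - 1)) - m * / (t * (exp (m * t) - 1))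
      + exp (- t) / (1 - exp (- t)) ^ 2
      - m / 2 * (n * / (exp (n * t) - 1)) - n / 2 * (m * / (exp (m * t) - 1)))
    (- / 2 + calC * (n + m) + (m - n) / 2 * ln (n / m)).
Proof.
intros m0 n0.
destruct bose_primitive_at_0 as [g0 G0]; destruct bose_primitive_at_infty as [g1 G1].
rewrite (calC_eq g0 g1 G0 G1), ln_div by auto.
replace (- / 2 + (g0 - g1) * (n + m) + (m - n) / 2 * (ln n - ln m)) with
  ((-1 * 0 - n * g1 - m * g1 - 0 - m / 2 * 0 - n / 2 * 0)
   - (/ 2 - n * g0 - m * g0 - m / 2 * 0 - n / 2 * 0 + (n - m) / 2 * (ln n - ln m))) by field.
apply newton_integral_intro with (fun t => -1 * / t - n * bose_primitive (n * t) - m * bose_primitive (m * t)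
  - / (exp t - 1) - m / 2 * ln (1 - exp (- (n * t))) - n / 2 * ln (1 - exp (- (m * t)))).
- assert (dL : forall c t, 0 < c -> 0 < t ->
    is_derive (fun t => ln (1 - exp (- (c * t)))) t (c * / (exp (c * t) - 1))).
  { intros c t c0 t0; evar_last.
    - apply (is_derive_comp (fun t => ln (1 - exp (- t))) (fun t => c * t)).
      + apply is_derive_ln_1_minus_exp; nra.
      + auto_derive; auto.
    - unfold scal; simpl; unfold mult; simpl; ring. }
  intros t t0; generalize (expm1_pos t t0); intros H; evar_last.
  + apply (is_derive_minus (fun t => -1 * / t - n * bose_primitive (n * t) - m * bose_primitive (m * t)
      - / (exp t - 1) - m / 2 * ln (1 - exp (- (n * t))))
      (fun t => n / 2 * ln (1 - exp (- (m * t))))).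
    * apply (is_derive_minus (fun t => -1 * / t - n * bose_primitive (n * t) - m * bose_primitive (m * t)
        - / (exp t - 1)) (fun t => m / 2 * ln (1 - exp (- (n * t))))).
      -- apply (is_derive_minus (fun t => -1 * / t - n * bose_primitive (n * t) - m * bose_primitive (m * t))
           (fun t => / (exp t - 1))).
         ++ apply (is_derive_minus (fun t => -1 * / t - n * bose_primitive (n * t))
              (fun t => m * bose_primitive (m * t))).
            ** apply (is_derive_minus (fun t => -1 * / t) (fun t => n * bose_primitive (n * t))).
               --- auto_derive; [lra | reflexivity].
               --- apply (is_derive_scal (fun t => bose_primitive (n * t))),
                     is_derive_bose_primitive_dilation; auto.
            ** apply (is_derive_scal (fun t => bose_primitive (m * t))),
                 is_derive_bose_primitive_dilation; auto.
         ++ auto_derive; [lra | reflexivity].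
      -- apply (is_derive_scal (fun t => ln (1 - exp (- (n * t))))), dL; auto.
    * apply (is_derive_scal (fun t => ln (1 - exp (- (m * t))))), dL; auto.
  + generalize (/ (exp (n * t) - 1)) (/ (exp (m * t) - 1))
      (/ (t * (exp (n * t) - 1))) (/ (t * (exp (m * t) - 1))); intros a b c d.
    unfold minus, plus, opp; simpl; rewrite exp_Ropp; field; lra.
- apply (filterlim_ext_loc (fun t => (/ t - / (exp t - 1))
    - n * (bose_primitive (n * t) + (/ (n * t) + ln (n * t) / 2))
    - m * (bose_primitive (m * t) + (/ (m * t) + ln (m * t) / 2))
    - m / 2 * (ln (1 - exp (- (n * t))) - ln (n * t))
    - n / 2 * (ln (1 - exp (- (m * t))) - ln (m * t)) + (n - m) / 2 * (ln n - ln m))).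
  + generalize at_right_0_pos; apply filter_imp; intros t t0.
    generalize (expm1_pos t t0); intros H; rewrite !ln_mult by auto; field; lra.
  + apply lim_plus; [|apply filterlim_const].
    apply lim_minus; [apply lim_minus; [apply lim_minus; [apply lim_minus|]|]|].
    * exact bose_at_0.
    * apply lim_scal, (lim_dilation_at_right_0 (fun x => bose_primitive x + (/ x + ln x / 2))); auto.
    * apply lim_scal, (lim_dilation_at_right_0 (fun x => bose_primitive x + (/ x + ln x / 2))); auto.
    * apply lim_scal, (lim_dilation_at_right_0 (fun x => ln (1 - exp (- x)) - ln x)); auto.
      exact ln_1_minus_exp_at_0.
    * apply lim_scal, (lim_dilation_at_right_0 (fun x => ln (1 - exp (- x)) - ln x)); auto.
      exact ln_1_minus_exp_at_0.
- apply lim_minus; [apply lim_minus; [apply lim_minus; [apply lim_minus; [apply lim_minus|]|]|]|].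
  + apply lim_scal, inv_p_infty.
  + apply lim_scal, lim_dilation_p_infty; auto.
  + apply lim_scal, lim_dilation_p_infty; auto.
  + exact bose_at_infty.
  + apply lim_scal, (lim_dilation_p_infty (fun x => ln (1 - exp (- x)))); auto.
    exact ln_1_minus_exp_at_infty.
  + apply lim_scal, (lim_dilation_p_infty (fun x => ln (1 - exp (- x)))); auto.
    exact ln_1_minus_exp_at_infty.
Qed.

Lemma sum_n_m_reverse (f : nat -> R) (N : nat) :
  sum_n_m f 1 N = sum_n_m (fun k => f (S N - k)%nat) 1 N.
Proof.
induction N as [|N IH]; [rewrite !sum_n_m_zero by lia; auto|].
rewrite sum_n_m_Sr, IH, (sum_Sn_m _ 1 (S N)) by lia.
rewrite <- sum_n_m_S; simpl (S (S N) - 1)%nat; rewrite Rplus_comm.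
apply (f_equal (Rplus (f (S N)))), sum_n_m_ext; reflexivity.
Qed.

Lemma cot_plus_INR_PI (x : R) (m : nat) : cot (x + INR m * PI) = cot x.
Proof.
induction m as [|m IH]; [simpl; f_equal; ring|].
rewrite S_INR; replace (x + (INR m + 1) * PI) with (x + INR m * PI + PI) by ring.
rewrite <- IH; unfold cot; rewrite neg_cos, neg_sin; unfold Rdiv; rewrite Rinv_opp; ring.
Qed.

Lemma cot_opp (x : R) : cot (- x) = - cot x.
Proof. unfold cot; rewrite cos_neg, sin_neg; unfold Rdiv; rewrite Rinv_opp; ring. Qed.

(** The reflection of [k] into [n - k] changes the sign of each term. Terms with vanishing sine are
    included: inversion is total and commutes with negation at 0 too. *)
Lemma sum_cot_eq_0 (m n : nat) :
  (1 <= n)%nat -> sum_n_m (fun k => cot (INR m * INR k * PI / INR n)) 1 (n - 1) = 0.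
Proof.
intros Hn; assert (n0 : 0 < INR n) by (apply lt_0_INR; lia).
assert (E : sum_n_m (fun k => cot (INR m * INR k * PI / INR n)) 1 (n - 1)
  = -1 * sum_n_m (fun k => cot (INR m * INR k * PI / INR n)) 1 (n - 1)); [|lra].
rewrite sum_n_m_reverse at 1; rewrite <- sum_n_m_Rmult_l.
apply sum_n_m_ext_loc; intros k Hk; replace (S (n - 1) - k)%nat with (n - k)%nat by lia.
rewrite minus_INR by lia.
replace (INR m * (INR n - INR k) * PI / INR n)
  with (- (INR m * INR k * PI / INR n) + INR m * PI) by (field; lra).
rewrite cot_plus_INR_PI, cot_opp; eq_in_R; ring.
Qed.

Lemma trigonometric_part_integral (m n : nat) :
  (1 <= n)%nat ->
  newton_integral (fun t => INR m / 2 * sum_n_m (fun k => cot (INR m * INR k * PI / INR n) *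
      (exp (- t) * sin (2 * (INR k * PI / INR n))
        / (1 - 2 * exp (- t) * cos (2 * (INR k * PI / INR n)) + exp (- t) ^ 2))) 1 (n - 1))
    (- (PI / 2 * sum_n_m (fun k =>
       INR m * INR k / INR n * cot (INR m * INR k * PI / INR n)) 1 (n - 1))).
Proof.
intros Hn; assert (n0 : 0 < INR n) by (apply lt_0_INR; lia).
assert (E : - (PI / 2 * sum_n_m (fun k =>
    INR m * INR k / INR n * cot (INR m * INR k * PI / INR n)) 1 (n - 1)) =
  INR m / 2 * sum_n_m (fun k =>
    cot (INR m * INR k * PI / INR n) * (PI / 2 - INR k * PI / INR n)) 1 (n - 1)).
(* The root with index [k] contributes [PI/2 - k PI/n]; its constant part [PI/2] meets the zero
   cotangent sum, inserted here. *)
{ transitivity (- (PI / 2) * sum_n_m (fun k =>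
    INR m * INR k / INR n * cot (INR m * INR k * PI / INR n)) 1 (n - 1)
    + INR m / 2 * (PI / 2) * sum_n_m (fun k => cot (INR m * INR k * PI / INR n)) 1 (n - 1)).
  - rewrite sum_cot_eq_0 by auto; ring.
  - rewrite <- !sum_n_m_Rmult_l, <- sum_n_m_Rplus.
    apply sum_n_m_ext; intros k; eq_in_R; field; lra. }
rewrite E; apply newton_integral_scal, newton_integral_sum; intros k Hk.
apply newton_integral_scal, root_of_unity_integral.
assert (1 <= INR k) by (change 1 with (INR 1); apply le_INR; lia).
assert (INR k < INR n) by (apply lt_INR; lia).
generalize PI_RGT_0; intros P; split; [apply Rdiv_lt_0_compat; nra|].
apply Rlt_div_l; nra.
Qed.

Lemma autocorr_integrand_decomposition (m n : nat) (t : R) :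
  (1 <= m)%nat -> (1 <= n)%nat -> Nat.gcd m n = 1%nat -> 0 < t ->
  INR m * INR n * autocorr_integrand m n t =
    (/ t ^ 2 - INR n * / (t * (exp (INR n * t) - 1)) - INR m * / (t * (exp (INR m * t) - 1))
      + exp (- t) / (1 - exp (- t)) ^ 2
      - INR m / 2 * (INR n * / (exp (INR n * t) - 1))
      - INR n / 2 * (INR m * / (exp (INR m * t) - 1)))
    + INR m / 2 * sum_n_m (fun k => cot (INR m * INR k * PI / INR n) *
        (exp (- t) * sin (2 * (INR k * PI / INR n))
          / (1 - 2 * exp (- t) * cos (2 * (INR k * PI / INR n)) + exp (- t) ^ 2))) 1 (n - 1)
    + INR n / 2 * sum_n_m (fun k => cot (INR n * INR k * PI / INR m) *
        (exp (- t) * sin (2 * (INR k * PI / INR m))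
          / (1 - 2 * exp (- t) * cos (2 * (INR k * PI / INR m)) + exp (- t) ^ 2))) 1 (m - 1).
Proof.
intros Hm Hn Hg t0.
assert (m0 : 0 < INR m) by (apply lt_0_INR; lia).
assert (n0 : 0 < INR n) by (apply lt_0_INR; lia).
assert (w1 : exp (- t) < 1) by (rewrite <- exp_0; apply exp_increasing; lra).
assert (wpow : forall p, exp (- t) ^ p = / exp (INR p * t)).
{ induction p as [|p IH]; [simpl; rewrite Rmult_0_l, exp_0; field|].
  rewrite S_INR, Rmult_plus_distr_r, Rmult_1_l, exp_plus, Rinv_mult, <- IH, <- (exp_Ropp t).
  apply Rmult_comm. }
assert (hp : forall p, 0 < p -> 0 < exp (p * t) - 1).
{ intros p p0; assert (pt : 0 < p * t) by nra; generalize (expm1_pos _ pt); lra. }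
assert (PF := partial_fractions (exp (- t)) (exp_pos _) w1 m n Hm Hn Hg).
generalize (hp _ m0) (hp _ n0); intros Hm' Hn'.
rewrite pow_add, !(wpow m), !(wpow n) in PF.
revert PF.
set (A := sum_n_m _ 1 (n - 1)); set (B := sum_n_m _ 1 (m - 1)).
(* The trigonometric sums, and below the two values [1/(e^{mt}-1)] and [1/(e^{nt}-1)], become
   indeterminates; the partial fraction identity is then a substitution for the product [x * y]. *)
generalize A B; clear A B; intros A B PF.
unfold autocorr_integrand.
rewrite !Rinv_mult.
replace (/ exp (INR m * t) * / exp (INR n * t)
  / ((1 - / exp (INR m * t)) * (1 - / exp (INR n * t))))
  with (/ (exp (INR m * t) - 1) * / (exp (INR n * t) - 1)) in PF by (field; lra).
replace (/ exp (INR m * t) / (1 - / exp (INR m * t)))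
  with (/ (exp (INR m * t) - 1)) in PF by (field; lra).
replace (/ exp (INR n * t) / (1 - / exp (INR n * t)))
  with (/ (exp (INR n * t) - 1)) in PF by (field; lra).
revert PF; generalize (/ (exp (INR m * t) - 1)) (/ (exp (INR n * t) - 1)); intros x y PF.
transitivity (/ t ^ 2 - INR n * (/ t * y) - INR m * (/ t * x) + INR m * INR n * (x * y)).
- field; lra.
- rewrite PF; field; lra.
Qed.

(** [RInt_gen] is a total function, so the convergence of each integral is asserted alongside the
    values. For [n = 1] or [m = 1] the range of the sum is empty and [sum_n_m] returns 0. *)
Theorem theorem1 :
  ex_RInt_gen calC_integrand_0_1 (at_right 0) (at_point 1) /\
  ex_RInt_gen calC_integrand_1_infty (at_point 1) (Rbar_locally p_infty) /\
  calC = / 2 * (ln (2 * PI) - euler_gamma) /\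
  forall m n : nat,
    (1 <= m)%nat -> (1 <= n)%nat -> Nat.gcd m n = 1%nat ->
    ex_RInt_gen (autocorr_integrand m n) (at_right 0) (Rbar_locally p_infty) /\
    INR m * INR n *
      RInt_gen (autocorr_integrand m n) (at_right 0) (Rbar_locally p_infty)
    = - / 2 + calC * (INR n + INR m)
      + (INR m - INR n) / 2 * ln (INR n / INR m)
      - PI / 2 * sum_n_m (fun k : nat =>
          INR m * INR k / INR n * cot (INR m * INR k * PI / INR n)) 1 (n - 1)
      - PI / 2 * sum_n_m (fun l : nat =>
          INR n * INR l / INR m * cot (INR n * INR l * PI / INR m)) 1 (m - 1).
Proof.
destruct bose_primitive_at_0 as [g0 G0]; destruct bose_primitive_at_infty as [g1 G1].
destruct (calC_integrals g0 g1 G0 G1) as [I0 I1].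
split; [eexists; exact I0|]; split; [eexists; exact I1|]; split; [exact calC_value|].
intros m n Hm Hn Hg.
assert (m0 : 0 < INR m) by (apply lt_0_INR; lia).
assert (n0 : 0 < INR n) by (apply lt_0_INR; lia).
assert (H := newton_integral_plus _ _ _ _ (newton_integral_plus _ _ _ _
  (singular_part_integral (INR m) (INR n) m0 n0) (trigonometric_part_integral m n Hn))
  (trigonometric_part_integral n m Hm)).
(* The assembled integrand is [m n] times the required one, so it is divided by [m n] before the
   passage to [RInt_gen]. *)
apply (newton_integral_scal _ (/ (INR m * INR n))) in H.
apply (newton_integral_ext _ (autocorr_integrand m n)) in H.
2: { intros t t0; rewrite <- autocorr_integrand_decomposition by auto; field; lra. }
apply newton_integral_is_RInt_gen in H.
2: { intros t t0; assert (mt : 0 < INR m * t) by nra; assert (nt : 0 < INR n * t) by nra.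
  generalize (expm1_pos _ mt) (expm1_pos _ nt); intros.
  apply (ex_derive_continuous (autocorr_integrand m n)); unfold autocorr_integrand.
  auto_derive; repeat split; lra. }
split; [eexists; exact H|].
rewrite (is_RInt_gen_unique _ _ H), <- Rmult_assoc, Rinv_r, Rmult_1_l by nra; ring.
Qed.
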